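(* Let $\mathbf{p}_1,\dots,\mathbf{p}_M$ be $M$ independent, uniformly distributed random points on $\mathbb{S}^3$, and let $\omega_N=\{\mathbf{p}_1,\dots,\mathbf{p}_M,-\mathbf{p}_1,\dots,-\mathbf{p}_M\}$ be the set of $N=2M$ points consisting of these points together with their antipodal points. Then $$ \mathbb{E}\left[E_0(\omega_N)\right]=-\frac{1}{4}N^2+\left(\frac{1}{2}-\log 2\right)N. $$
   Context: For $\omega_N=\{x_1,\dots,x_N\}\subset\mathbb{S}^3\subset\mathbb{R}^4$, the logarithmic energy is $E_0(\omega_N)=\sum_{i\neq j}\log\frac{1}{\|x_i-x_j\|}$, the sum being over ordered pairs $(i,j)$, $1\le i,j\le N$, $i\ne j$, with $\|\cdot\|$ the Euclidean norm. ''Uniformly distributed'' means distributed according to normalized surface measure. *)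

(* Defs.v *)
From HB Require Import structures.
From mathcomp Require Import all_boot all_order all_algebra.
From mathcomp Require Import all_classical all_reals all_analysis.

Set Implicit Arguments.
Unset Strict Implicit.
Unset Printing Implicit Defensive.

Import Order.TTheory GRing.Theory Num.Theory.
Import numFieldNormedType.Exports.

Local Open Scope classical_set_scope.
Local Open Scope ring_scope.

(* Nested products rather than 'rV[R]_4, because products carry the Borel
   (product) sigma-algebra and the product of Lebesgue measures. *)
Notation R4 R := ((Real.sort R * Real.sort R) * (Real.sort R * Real.sort R))%type.

(* The library norm `|x| on a product is the sup norm, hence this definition. *)
Definition enorm (R : realType) (x : R4 R) : R :=
  Num.sqrt (x.1.1 ^+ 2 + x.1.2 ^+ 2 + x.2.1 ^+ 2 + x.2.2 ^+ 2).

Definition S3 (R : realType) : set (R4 R) := [set x | enorm x = 1].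

(* For coinciding points, 1 / 0 = +oo and the logarithm is +oo in \bar R. *)
Definition log_energy (R : realType) (N : nat) (x : 'I_N -> R4 R) : \bar R :=
  (\sum_(i < N) \sum_(j < N | i != j) lne (1 / (enorm (x i - x j))%:E))%E.

Definition with_antipodes (R : realType) (M : nat) (x : 'I_M -> R4 R)
    (k : 'I_(M + M)) : R4 R :=
  match fintype.split k with inl i => x i | inr i => - x i end.

Section lebesgue_R2_R4.
Variable R : realType.
Local Notation mu := (@lebesgue_measure R).
Local Notation TR := (measurableTypeR R).

(* Named because the library infers no sigma-finite structure on mu \x mu,
   and that structure is needed to form the second product. *)
Definition lebesgue2 : set (TR * TR) -> \bar R := (mu \x mu)%E.

HB.instance Definition _ := Measure.copy lebesgue2 (mu \x mu)%E.

Let lebesgue2_sigma_finite : sigma_finite setT lebesgue2.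
Proof.
have /sigma_finiteP[F [TF ndF Foo]] := sigma_finiteT mu.
exists (fun n => F n `*` F n).
  rewrite predeqE => -[x y]; split => // _.
  have : setT x by []. have : setT y by [].
  rewrite {1 2}TF => -[k _ Fky] [n _ Fnx].
  exists (maxn n k) => //; split.
  - by move: x Fnx; exact/subsetPset/ndF/leq_maxl.
  - by move: y Fky; exact/subsetPset/ndF/leq_maxr.
move=> k; have [mF Fk] := Foo k; split; first exact: measurableX.
by rewrite /lebesgue2 product_measure1E// lte_mul_pinfty// ge0_fin_numE.
Qed.

HB.instance Definition _ :=
  Measure_isSigmaFinite.Build _ _ _ lebesgue2 lebesgue2_sigma_finite.

Definition lebesgue4 : set ((TR * TR) * (TR * TR)) -> \bar R :=
  (lebesgue2 \x lebesgue2)%E.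

HB.instance Definition _ := Measure.copy lebesgue4 (lebesgue2 \x lebesgue2)%E.

End lebesgue_R2_R4.

Definition cone (R : realType) (A : set (R4 R)) : set (R4 R) :=
  [set y | exists (t : R) (x : R4 R), [/\ 0 < t, t <= 1, A x & y = t *: x]].

(* Surface measure on the unit sphere of R^n through polar coordinates:
   sigma(A) = n * Leb_n {t x | 0 < t <= 1, x in A}, here with n = 4.
   A Borel set of R^4 is first intersected with the sphere. *)
Definition surface_measure (R : realType) (A : set (R4 R)) : \bar R :=
  (4%:E * lebesgue4 (cone (A `&` @S3 R)))%E.

Definition normalized_surface_measure (R : realType) (A : set (R4 R)) : \bar R :=
  (surface_measure A / surface_measure (@S3 R))%E.

Definition uniform_on_S3 (d : measure_display) (T : measurableType d)
    (R : realType) (P : probability T R) (X : {RV P >-> R4 R}) : Prop :=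
  (forall w, S3 (X w)) /\
  (forall A : set (R4 R), measurable A ->
     distribution P X A = normalized_surface_measure A).

Definition mutually_independent (d d' : measure_display)
    (T : measurableType d) (T' : measurableType d') (R : realType)
    (P : probability T R) (n : nat) (X : 'I_n -> {RV P >-> T'}) : Prop :=
  forall (J : {set 'I_n}) (A : 'I_n -> set T'),
    (forall i, i \in J -> measurable (A i)) ->
    P (\bigcap_(i in [set` J]) X i @^-1` A i) =
    (\big[*%E/1%E]_(i in J) P (X i @^-1` A i))%E.

(* Main.v *)
Require Import Defs.
From HB Require Import structures.
From mathcomp Require Import all_boot all_order all_algebra.
From mathcomp Require Import all_classical all_reals all_analysis.
From mathcomp Require Import measurable_realfun ring lra.

Import Order.TTheory GRing.Theory Num.Theory.
Import numFieldNormedType.Exports.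

Local Open Scope classical_set_scope.
Local Open Scope ring_scope.

(* For x, y on the sphere and t = <x, y>, the four pairs (+-x, +-y) contribute
   - 2 ln |x - y| - 2 ln |x + y| = - ln (4 (1 - t ^ 2)), so everything reduces
   to E[- ln (1 - t ^ 2)] = 2 ln 2 - 1 for y uniform and x fixed.

   Lebesgue measure is invariant under shears, a plane rotation is a product
   of three shears, and plane rotations carry x to a basis vector.  Slicing the
   4-ball by planes then shows that t is distributed as the first coordinate a
   of a uniform point of the unit disc (the area of the disc, pi, is never
   computed: it cancels).

   To compute J, the integral of - ln (1 - a ^ 2) over the disc, integrate
   - ln (1 - a ^ 2 - q ^ 2) over the 3-ball {a ^ 2 + b ^ 2 + q ^ 2 < 1} twice.
   Slicing by q and rescaling each slice to the unit disc gives
   4 / 3 J + area * (20 / 9 - 8 / 3 ln 2); slicing by b leaves, on each slice,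
   a radial integrand in (a, q), and the total is area * 8 / 9. *)

(** * Syntax-directed measurability proofs *)

Ltac meas1 := lazymatch goal with
  | |- measurable_fun _ (fun z => z) => exact: measurable_id
  | |- measurable_fun _ (fun z => (@?f z, @?g z)) => apply: (@measurable_fun_pair _ _ _ _ _ _ f g)
  | |- measurable_fun _ (fun z => (@?f z + - @?g z)%R) => apply: (@measurable_funB _ _ _ _ f g)
  | |- measurable_fun _ (fun z => (@?f z + @?g z)%R) => apply: (@measurable_funD _ _ _ _ f g)
  | |- measurable_fun _ (fun z => (@?f z * @?g z)%R) => apply: (@measurable_funM _ _ _ _ f g)
  | |- measurable_fun _ (fun z => (@?f z ^+ ?n)%R) => apply: (@measurable_funX _ _ _ _ f n)
  | |- measurable_fun _ (fun z => fst z) => exact: measurable_fst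
  | |- measurable_fun _ (fun z => snd z) => exact: measurable_snd
  | |- measurable_fun _ (fun z => fst (@?f z)) =>
      apply: (measurableT_comp (f := fst) measurable_fst (g := f))
  | |- measurable_fun _ (fun z => snd (@?f z)) =>
      apply: (measurableT_comp (f := snd) measurable_snd (g := f))
  | H : measurable_fun _ ?h |- measurable_fun _ (fun z => ?h (@?f z)) =>
      apply: (measurableT_comp H (g := f))
  | |- measurable_fun _ (fun _ => _) => exact: measurable_cst
  end.
Ltac meas := repeat first [ assumption | meas1 ].

(** * Rotation invariance and polar coordinates in the plane *)

Section plane_integrals.
Context {R : realType}.
Local Notation TR := (measurableTypeR R).
Local Notation mu := (@lebesgue_measure R).

Lemma measurable_affine (r c : R) :
  measurable_fun setT ((fun x => r * x + c) : TR -> TR).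
Proof. by apply: measurable_funD => //; exact: measurable_funM. Qed.

(** The pushforward of [mu] under the affine map, multiplied by [r], gives each half-open interval
    its length; uniqueness of Lebesgue measure does the rest. *)
Lemma lebesgue_measure_affine (r c : R) (A : set TR) : 0 < r -> measurable A ->
  (r%:E * mu ((fun x => r * x + c)%R @^-1` A))%E = mu A.
Proof.
move=> r0 mA.
pose p : {measure set TR -> \bar R} := 
  measure_function_pushforward__canonical__measure_function_Measure mu (measurable_affine r c).
pose m := mscale (NngNum (ltW r0)) p.
rewrite [RHS](@lebesgue_measure_unique R m)// => _ [[a b]] _ <-.
suff: mu `]a, b] = (r%:E * mu ((fun x : TR => r * x + c)%R @^-1` `]a, b]))%E by [].
rewrite (_ : _ @^-1` _ = `](a - c) / r, (b - c) / r]%classic); last first.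
  apply/seteqP; split => x /=; rewrite !in_itv/= ltr_pdivrMr// ler_pdivlMr// !(mulrC x); lra.
rewrite !lebesgue_measure_itv/= !lte_fin ltr_pM2r ?invr_gt0// ltrD2r.
case: ifPn => // ab; last by rewrite mule0.
by rewrite -!EFinB -EFinM; congr EFin; field; rewrite gt_eqF.
Qed.

Lemma ge0_integral_affine (r c : R) (f : TR -> \bar R) : 0 < r ->
    measurable_fun setT f -> (forall x, (0 <= f x)%E) ->
  (r%:E * \int[mu]_x f (r * x + c)%R)%E = (\int[mu]_x f x)%E.
Proof.
move=> r0 mf f0.
pose p : {measure set TR -> \bar R} := 
  measure_function_pushforward__canonical__measure_function_Measure mu (measurable_affine r c).
pose m := mscale (NngNum (ltW r0)) p.
rewrite [RHS](eq_measure_integral m); last first.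
  by move=> A mA _; rewrite /m /mscale/=; exact/esym/lebesgue_measure_affine.
by rewrite ge0_integral_mscale//= ge0_integral_pushforward//; exact: measurable_affine.
Qed.

Lemma lebesgue2_fubini (F : TR * TR -> \bar R) :
    measurable_fun setT F -> (forall z, (0 <= F z)%E) ->
  (\int[@lebesgue2 R]_z F z = \int[mu]_x \int[mu]_y F (x, y))%E.
Proof. by move=> mF F0; rewrite -(fubini_tonelli1 F). Qed.

Lemma ge0_integral_translation (c : R) (f : TR -> \bar R) :
    measurable_fun setT f -> (forall x, (0 <= f x)%E) ->
  (\int[mu]_x f (x + c)%R)%E = (\int[mu]_x f x)%E.
Proof.
move=> mf f0; rewrite -[RHS](ge0_integral_affine 1 c)// mul1e.
by under [in RHS]eq_integral do rewrite mul1r.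
Qed.

Lemma ge0_integral_shear2 (t : R) (F : TR * TR -> \bar R) :
    measurable_fun setT F -> (forall z, (0 <= F z)%E) ->
  (\int[mu]_x \int[mu]_y F (x, (y + t * x)%R) = \int[mu]_x \int[mu]_y F (x, y))%E.
Proof.
move=> mF F0; apply: eq_integral => x _.
by rewrite (ge0_integral_translation _ (fun y => F (x, y)))//; exact: measurable_fun_pair2.
Qed.

(** The sheared variable is the outer one, so Tonelli first exchanges the integrals; then the shear
    is a translation for each fixed [y]. *)
Lemma ge0_integral_shear1 (t : R) (F : TR * TR -> \bar R) :
    measurable_fun setT F -> (forall z, (0 <= F z)%E) ->
  (\int[mu]_x \int[mu]_y F ((x + t * y)%R, y) = \int[mu]_x \int[mu]_y F (x, y))%E.
Proof.
move=> mF F0; rewrite [RHS](fubini_tonelli F mF F0).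
rewrite (fubini_tonelli (fun z : TR * TR => F ((z.1 + t * z.2)%R, z.2))); [|by meas|by []].
apply: eq_integral => y _ /=.
by rewrite (ge0_integral_translation _ (fun x => F (x, y)))//; exact: measurable_fun_pair1.
Qed.

Lemma ge0_integral_rotation (c s : R) (F : TR * TR -> \bar R) :
    c ^+ 2 + s ^+ 2 = 1 ->
    measurable_fun setT F -> (forall z, (0 <= F z)%E) ->
  (\int[mu]_x \int[mu]_y F ((c * x - s * y)%R, (s * x + c * y)%R) =
   \int[mu]_x \int[mu]_y F (x, y))%E.
Proof.
move=> + mF F0.
(* x' = x - t y, y' = y + s x', x'' = x' - t y' with t = tan (angle / 2) *)
have generic c' s' : c' ^+ 2 + s' ^+ 2 = 1 -> c' != -1 ->
    forall G : TR * TR -> \bar R, measurable_fun setT G -> (forall z, (0 <= G z)%E) ->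
  (\int[mu]_x \int[mu]_y G ((c' * x - s' * y)%R, (s' * x + c' * y)%R) =
   \int[mu]_x \int[mu]_y G (x, y))%E.
  move=> cs1 c1 G mG G0; pose t := s' / (1 + c').
  have c10 : 1 + c' != 0 by apply: contra_neq c1; lra.
  have ts : 1 - s' * t = c' by rewrite /t mulrA -expr2 (_ : s' ^+ 2 = (1 - c') * (1 + c')) ?mulfK//; [ring | lra].
  have tc : t * (1 + c') = s' by rewrite /t divfK.
  rewrite -(ge0_integral_shear1 (- t) G mG G0).
  rewrite -(ge0_integral_shear2 s' (fun z : TR * TR => G ((z.1 + - t * z.2)%R, z.2)));
    [|by meas|by []].
  rewrite -(ge0_integral_shear1 (- t) (fun z : TR * TR =>
     G ((z.1 + - t * (z.2 + s' * z.1))%R, (z.2 + s' * z.1)%R))); [|by meas|by []].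
  apply: eq_integral => x _; apply: eq_integral => y _ /=; congr G; congr pair.
  - transitivity ((1 - s' * t) * x - (t * (1 + (1 - s' * t))) * y); last by ring.
    by rewrite ts tc.
  - by transitivity (s' * x + (1 - s' * t) * y); [rewrite ts | ring].
(* The half-turn has no finite tan (angle / 2); it is obtained below as two quarter-turns, with
   cosine 0 and sine 1. *)
move=> cs1; have [c1|c1] := eqVneq c (-1); last exact: (generic _ _ cs1 c1 F mF F0).
have s0 : s = 0.
  by apply/eqP; rewrite -sqrf_eq0; apply/eqP; move: cs1; rewrite c1 => h; lra.
rewrite {}c1 {}s0.
have cs01 : (0 : R) ^+ 2 + 1 ^+ 2 = 1 by ring.
have c01 : (0 : R) != -1 by rewrite eq_sym oppr_eq0 oner_eq0.
rewrite -(generic _ _ cs01 c01 F mF F0).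
rewrite -(generic _ _ cs01 c01 (fun z : TR * TR =>
  F ((0 * z.1 - 1 * z.2)%R, (1 * z.1 + 0 * z.2)%R))); [|by meas|by []].
by apply: eq_integral => x _; apply: eq_integral => y _ /=; congr F; congr pair; ring.
Qed.

(** The rotation taking [(al, be) / rho] to the first axis turns the linear form into [rho] times
    the first coordinate and preserves [x ^+ 2 + y ^+ 2]. For [rho = 0] there is no direction to
    rotate, but both forms vanish. *)
Lemma ge0_integral_linear_radial (al be : R) (f : TR * TR -> \bar R) :
    measurable_fun setT f -> (forall z, (0 <= f z)%E) ->
  (\int[mu]_x \int[mu]_y f ((al * x + be * y)%R, (x ^+ 2 + y ^+ 2)%R) =
   \int[mu]_x \int[mu]_y f ((Num.sqrt (al ^+ 2 + be ^+ 2) * x)%R, (x ^+ 2 + y ^+ 2)%R))%E.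
Proof.
move=> mf f0; set rho := Num.sqrt _.
have rho2 : rho ^+ 2 = al ^+ 2 + be ^+ 2 by rewrite sqr_sqrtr// addr_ge0 ?sqr_ge0.
have [rho0|rho0] := eqVneq rho 0.
  have /andP[/eqP -> /eqP ->] : (al == 0) && (be == 0).
    by rewrite -(sqrf_eq0 al) -(sqrf_eq0 be) -paddr_eq0 ?sqr_ge0// -rho2 rho0 expr0n.
  by apply: eq_integral => x _; apply: eq_integral => y _; rewrite rho0 !mul0r addr0.
have cs1 : (al / rho) ^+ 2 + (- be / rho) ^+ 2 = 1.
  by rewrite !expr_div_n -mulrDl sqrrN -rho2 divff// sqrf_eq0.
rewrite -(ge0_integral_rotation _ _ (fun z : TR * TR => f ((rho * z.1)%R, (z.1 ^+ 2 + z.2 ^+ 2)%R)) cs1);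
  [|by meas|by []].
apply: eq_integral => x _; apply: eq_integral => y _ /=; congr f; congr pair.
  by field.
transitivity (((al / rho) ^+ 2 + (- be / rho) ^+ 2) * (x ^+ 2 + y ^+ 2)); last by ring.
by rewrite cs1 mul1r.
Qed.

Lemma ge0_integral_scale2 (r : R) (F : TR * TR -> \bar R) : 0 < r ->
    measurable_fun setT F -> (forall z, (0 <= F z)%E) ->
  ((r ^+ 2)%:E * \int[mu]_x \int[mu]_y F ((r * x)%R, (r * y)%R) =
   \int[mu]_x \int[mu]_y F (x, y))%E.
Proof.
move=> r0 mF F0.
have mi : measurable_fun setT (fun x : TR => \int[mu]_y F (x, y))%E.
  exact: measurable_fun_fubini_tonelli_F.
have i0 x : (0 <= \int[mu]_y F (x, y))%E by exact: integral_ge0.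
rewrite -(ge0_integral_affine r 0 (fun x : TR => \int[mu]_y F (x, y))%E r0 mi i0).
rewrite expr2 EFinM -muleA; congr (_ * _)%E.
rewrite -ge0_integralZl//=; last 3 first.
- apply: (@measurable_fun_fubini_tonelli_F _ _ _ _ _ mu (fun z : TR * TR => F ((r * z.1)%R, (r * z.2)%R))) => //.
  by meas.
- by move=> x _; exact: integral_ge0.
- by rewrite lee_fin ltW.
apply: eq_integral => x _; rewrite addr0.
rewrite -[RHS](ge0_integral_affine r 0)//; last exact: measurable_fun_pair2.
by congr (_ * _)%E; apply: eq_integral => y _; rewrite addr0.
Qed.

(** Indexed by the squared radius, so that the area is linear in [d]. *)
Definition disc (d : R) : set (TR * TR) := [set z | z.1 ^+ 2 + z.2 ^+ 2 <= d].

Lemma measurable_disc d : measurable (disc d).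
Proof.
have -> : disc d = (fun z : TR * TR => z.1 ^+ 2 + z.2 ^+ 2) @^-1` `]-oo, d].
  by apply/seteqP; split => z /=; rewrite in_itv.
rewrite -[X in measurable X]setTI.
have mf : measurable_fun setT (fun z : TR * TR => z.1 ^+ 2 + z.2 ^+ 2) by meas.
by apply: mf => //; exact: measurable_itv.
Qed.

Lemma lebesgue2_disc_scale d : 0 < d ->
  lebesgue2 (disc d) = (d%:E * lebesgue2 (disc 1))%E.
Proof.
move=> d0.
have indicE' e : (lebesgue2 (disc e) = \int[@lebesgue2 R]_z (\1_(disc e) z)%:E)%E.
  by rewrite integral_indic ?setIT//; exact: measurable_disc.
rewrite !indicE'.
have mi e : measurable_fun setT (EFin \o (\1_(disc e) : TR * TR -> R)).
  by apply/measurable_EFinP; apply: measurable_indic; exact: measurable_disc.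
rewrite !lebesgue2_fubini//=.
- have r0 : 0 < Num.sqrt d by rewrite sqrtr_gt0.
  rewrite -(ge0_integral_scale2 _ _ r0 (mi d))/=; last by move=> z; rewrite lee_fin.
  rewrite (sqr_sqrtr (ltW d0)); apply: (congr1 (fun x => d%:E * x)%E).
  apply: eq_integral => x _; apply: eq_integral => y _; congr EFin.
  rewrite !indicE; congr (nat_of_bool _)%:R; rewrite /disc.
  by apply/idP/idP; rewrite !inE/= !exprMn (sqr_sqrtr (ltW d0)) -mulrDr ger_pMr.
- exact: mi.
- exact: mi.
Qed.

Lemma lebesgue2_disc_gt0 : (0 < lebesgue2 (disc 1))%E.
Proof.
have : (lebesgue2 (`[0%R, 2^-1%R]%classic `*` `[0%R, 2^-1%R]%classic : set (TR * TR)) <= lebesgue2 (disc 1))%E.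
  apply: le_measure; rewrite ?inE.
  - by apply: measurableX; exact: measurable_itv.
  - exact: measurable_disc.
  - move=> [x y]/=; rewrite !in_itv/= /disc/= => -[/andP[x0 x1] /andP[y0 y1]]. nra.
apply: lt_le_trans.
rewrite /lebesgue2 product_measure1E//=; try exact: measurable_itv.
by rewrite lebesgue_measure_itv/= lte_fin invr_gt0 ltr0n/= oppr0 adde0 -EFinM lte_fin mulr_gt0.
Qed.

Lemma lebesgue2_disc_lty : (lebesgue2 (disc 1) < +oo)%E.
Proof.
have : (lebesgue2 (disc 1) <= lebesgue2 (`[(-1)%R, 1%R]%classic `*` `[(-1)%R, 1%R]%classic : set (TR * TR)))%E.
  apply: le_measure; rewrite ?inE.
  - exact: measurable_disc.
  - by apply: measurableX; exact: measurable_itv.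
  - by move=> [x y]/=; rewrite !in_itv/= /disc/= => xy; split; apply/andP; split; nra.
move=> /le_lt_trans; apply.
rewrite /lebesgue2 product_measure1E//=; try exact: measurable_itv.
by rewrite !lebesgue_measure_itv/=; case: ifPn => _; rewrite ?mul0e//= -EFinM ltry.
Qed.

Definition disc_area : R := fine (lebesgue2 (disc 1)).

Lemma disc_areaE : lebesgue2 (disc 1) = disc_area%:E.
Proof. by rewrite fineK// ge0_fin_numE// lebesgue2_disc_lty. Qed.

Lemma disc_area_gt0 : 0 < disc_area.
Proof. by rewrite -lte_fin -disc_areaE lebesgue2_disc_gt0. Qed.

(** For [d > 0] this is scaling by the square root of [d]; for [d <= 0] the disc contains at most
    the origin, hence is null. *)
Lemma lebesgue2_disc d : lebesgue2 (disc d) = (disc_area * Num.max d 0)%:E.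
Proof.
have [d0|] := ltP 0 d.
  by rewrite lebesgue2_disc_scale// disc_areaE -EFinM mulrC.
rewrite mulr0 => d0; apply/eqP; rewrite eq_le measure_ge0 andbT.
have : (lebesgue2 (disc d) <= lebesgue2 ([set 0%R] `*` [set 0%R] : set (TR * TR)))%E.
  apply: le_measure; rewrite ?inE.
  - exact: measurable_disc.
  - by apply: measurableX.
  - move=> [x y]; rewrite /disc/= => /le_trans/(_ d0) xy.
    have : x ^+ 2 + y ^+ 2 == 0 by rewrite eq_le xy addr_ge0 ?sqr_ge0.
    by rewrite paddr_eq0 ?sqr_ge0// !sqrf_eq0 => /andP[/eqP -> /eqP ->].
move=> /le_trans; apply.
by rewrite /lebesgue2 product_measure1E//= lebesgue_measure_set1 mul0e.
Qed.

Let sq2 (z : TR * TR) : TR := z.1 ^+ 2 + z.2 ^+ 2.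

Let measurable_sq2 : measurable_fun setT sq2. Proof. by rewrite /sq2; meas. Qed.

Let pos_itv : set TR := `]0, +oo[%classic.

(** The squared norm pushes planar Lebesgue measure to a multiple of Lebesgue measure on the
    positive half-line. Uniqueness of Lebesgue measure needs a measure on the whole line, so the
    pushforward divided by [disc_area] is completed by [mu] on the nonpositive half-line. *)
Lemma lebesgue2_sq2 (A : set TR) : measurable A -> A `<=` pos_itv ->
  lebesgue2 (sq2 @^-1` A) = (disc_area%:E * mu A)%E.
Proof.
move=> mA Apos.
have mpos : measurable pos_itv by exact: measurable_itv.
have mneg : measurable (~` pos_itv) by exact: measurableC.
have k0 : 0 <= disc_area^-1 by rewrite invr_ge0 ltW// disc_area_gt0.
pose p : {measure set TR -> \bar R} :=
  measure_function_pushforward__canonical__measure_function_Measure (@lebesgue2 R) measurable_sq2.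
pose m1 : {measure set TR -> \bar R} := mscale (NngNum k0) p.
pose m2 : {measure set TR -> \bar R} := mrestr mu mneg.
pose m : {measure set TR -> \bar R} := measure_add m1 m2.
have mE X : m X = (disc_area^-1%:E * lebesgue2 (sq2 @^-1` X) + mu (X `&` ~` pos_itv))%E.
  exact: measure_addE.
have muE : mu A = m A.
  apply: lebesgue_measure_unique => // _ [[a b]] _ <-; rewrite mE /=.
  have [ab|ba] := ltP a b; last first.
    by rewrite set_itv_ge ?bnd_simp -?leNgt// preimage_set0 set0I !measure0 mule0 adde0.
  have -> : sq2 @^-1` `]a, b] = disc b `\` disc a.
    apply/seteqP; split => z; rewrite /disc/= in_itv/=.
      by move=> /andP[? ?]; split => //; apply/negP; rewrite -ltNge.
    by move=> [-> /negP]; rewrite -ltNge => ->.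
  have -> : `]a, b] `&` ~` pos_itv = [set` `]a, Num.min b 0]].
    apply/seteqP; split => x; rewrite /pos_itv /= !in_itv/= andbT le_min.
      by move=> [/andP[-> ->] /negP]; rewrite -leNgt => ->.
    by move=> /and3P[-> -> ?]; split => //; apply/negP; rewrite -leNgt.
  rewrite measureD//=; [|exact: measurable_disc..|by rewrite lebesgue2_disc ltry].
  rewrite (_ : disc b `&` disc a = disc a); last first.
    by apply: setIidr => z; rewrite /disc/= => /le_trans; apply; exact: ltW.
  rewrite !lebesgue2_disc !lebesgue_measure_itv/= !lte_fin ab -!EFinB -EFinM.
  rewrite -mulrBr mulKf ?gt_eqF ?disc_area_gt0//.
  (* The signs of [a] and [b] decide how the length of the interval is shared between the annulus
     and the nonpositive half-line. *)
  have [b0|b0] := ltP 0 b; have [a0|a0] := ltP 0 a.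
  - by rewrite ifF ?adde0//; apply/negbTE; rewrite -leNgt ltW.
  - rewrite lt_neqAle a0 andbT; case: eqVneq => [->|_] /=.
      by rewrite adde0.
    by rewrite -EFinD; congr EFin; ring.
  - by move: (lt_trans a0 ab); rewrite ltNge b0.
  - by rewrite ab subrr add0e.
rewrite muE mE (_ : A `&` ~` pos_itv = set0); last first.
  by apply/subsets_disjoint.
by rewrite measure0 adde0 muleA -EFinM mulfV ?gt_eqF ?disc_area_gt0// mul1e.
Qed.

Lemma ge0_integral_planar (G : TR -> \bar R) :
    measurable_fun setT G -> (forall s, (0 <= G s)%E) ->
  (\int[mu]_x \int[mu]_y G (x ^+ 2 + y ^+ 2)%R =
   disc_area%:E * \int[mu]_(s in `]0%R, +oo[) G s)%E.
Proof.
move=> mG G0.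
have mpos : measurable pos_itv by exact: measurable_itv.
have k0 : 0 <= disc_area by rewrite ltW// disc_area_gt0.
pose p : {measure set TR -> \bar R} :=
  measure_function_pushforward__canonical__measure_function_Measure (@lebesgue2 R) measurable_sq2.
pose m1 : {measure set TR -> \bar R} := mscale (NngNum k0) mu.
have mGs : measurable_fun setT (G \o sq2) by exact: measurableT_comp.
rewrite -(lebesgue2_fubini (G \o sq2))//; last by move=> z; exact: G0.
transitivity (\int[p]_s G s)%E; first by rewrite ge0_integral_pushforward.
transitivity (\int[p]_(s in pos_itv) G s)%E; last first.
  rewrite (eq_measure_integral m1) => [|A mA Apos]; last exact: lebesgue2_sq2.
  by rewrite ge0_integral_mscale//; exact: measurable_funTS.
have mneg : measurable (~` pos_itv) by exact: measurableC.
(* The pushforward gives no mass to the nonpositive half-line: its preimage is [disc 0], a null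
   set. *)
rewrite -(setUv pos_itv) ge0_integral_setU//=.
- rewrite [X in (_ + X)%E](_ : _ = 0%E) ?adde0//.
  apply: null_set_integral => //; first exact: measurable_funTS.
  rewrite (_ : p _ = lebesgue2 (disc 0)); first by rewrite lebesgue2_disc maxxx mulr0.
  suff <- : sq2 @^-1` (~` pos_itv) = disc 0 by [].
  apply/seteqP; split => z; rewrite /pos_itv/= in_itv/= andbT.
    by move=> /negP; rewrite -leNgt.
  by move=> ?; apply/negP; rewrite -leNgt.
- by rewrite setUv.
- by apply/disj_setPCl.
Qed.
End plane_integrals.

(** * Reduction of zonal integrals over the 4-ball to the disc *)

Section zonal_reduction.
Context {R : realType}.
Local Notation TR := (measurableTypeR R).
Local Notation mu := (@lebesgue_measure R).
Local Notation disc_area := (@disc_area R).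

(** Inversion is discontinuous at 0, so it is written through [expR] and [ln]; at 0 the factor [x]
    gives the conventional value [0^-1 = 0]. *)
Lemma measurable_invr : measurable_fun setT (@GRing.inv R : TR -> TR).
Proof.
have -> : (@GRing.inv R) = fun x => x * expR (- ln (x ^+ 2)).
  apply/funext => x; have [->|x0] := eqVneq x 0; first by rewrite invr0 mul0r.
  rewrite expRN lnK ?posrE ?exprn_even_gt0//; by field.
apply: measurable_funM; first exact: measurable_id.
apply: measurableT_comp; first exact: measurable_expR.
apply: measurableT_comp; first exact: oppr_measurable.
by apply: measurableT_comp; [exact: measurable_ln | exact: exprn_measurable].
Qed.

Lemma measurable_sqrtr : measurable_fun setT (@Num.sqrt R : TR -> TR).
Proof. by apply: continuous_measurable_fun; exact: sqrt_continuous. Qed.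

Lemma ge0_integral_lebesgue4 (F : (TR * TR) * (TR * TR) -> \bar R) :
    measurable_fun setT F -> (forall z, (0 <= F z)%E) ->
  (\int[@lebesgue4 R]_z F z =
   \int[mu]_a \int[mu]_b \int[mu]_c \int[mu]_d F ((a, b), (c, d)))%E.
Proof.
move=> mF F0; rewrite -[LHS]/(\int[(@lebesgue2 R \x @lebesgue2 R)%E]_z F z)%E.
rewrite (fubini_tonelli1 F mF F0) /fubini_F.
have mFu (u : TR * TR) : measurable_fun setT (fun v => F (u, v)).
  exact: measurable_fun_pair2.
rewrite lebesgue2_fubini; last 2 first.
- exact: (measurable_fun_fubini_tonelli_F F).
- by move=> u; exact: integral_ge0.
apply: eq_integral => a _; apply: eq_integral => b _.
by rewrite (lebesgue2_fubini (fun v => F ((a, b), v))).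
Qed.

(** Rotations in the planes (c, d) and (a, b) reduce the linear form to [be * c + al * a]. The
    coordinates b and d then enter only through their squares and are integrated in polar form. A
    last rotation, in the plane (c, a), leaves one coordinate with coefficient 1. *)
Lemma ge0_integral4_linear_radial (x : (TR * TR) * (TR * TR)) (f : TR * TR -> \bar R) :
    x.1.1 ^+ 2 + x.1.2 ^+ 2 + x.2.1 ^+ 2 + x.2.2 ^+ 2 = 1 ->
    measurable_fun setT f -> (forall z, (0 <= f z)%E) ->
  (\int[@lebesgue4 R]_y
     f ((x.1.1 * y.1.1 + x.1.2 * y.1.2 + x.2.1 * y.2.1 + x.2.2 * y.2.2)%R,
        (y.1.1 ^+ 2 + y.1.2 ^+ 2 + y.2.1 ^+ 2 + y.2.2 ^+ 2)%R) =
   disc_area%:E * \int[mu]_a \int[mu]_b \int[mu]_(s in `]0%R, +oo[)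
     f (a, (a ^+ 2 + b ^+ 2 + s)%R))%E.
Proof.
case: x => -[x1 x2] [x3 x4]/= x1E mf f0.
pose al := Num.sqrt (x1 ^+ 2 + x2 ^+ 2); pose be := Num.sqrt (x3 ^+ 2 + x4 ^+ 2).
rewrite ge0_integral_lebesgue4; [|by meas|by []].
transitivity (\int[mu]_a \int[mu]_b \int[mu]_c \int[mu]_d
    f ((x1 * a + x2 * b + be * c)%R, (a ^+ 2 + b ^+ 2 + (c ^+ 2 + d ^+ 2))%R))%E.
  apply: eq_integral => a _; apply: eq_integral => b _.
  rewrite -(ge0_integral_linear_radial x3 x4 (fun z : TR * TR =>
    f ((x1 * a + x2 * b + z.1)%R, (a ^+ 2 + b ^+ 2 + z.2)%R))); [|by meas|by []].
  by apply: eq_integral => c _; apply: eq_integral => d _ /=; rewrite !addrA.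
pose F1 (z : (TR * TR) * (TR * TR)) := f ((x1 * z.1.1 + x2 * z.1.2 + be * z.2.1)%R,
  (z.1.1 ^+ 2 + z.1.2 ^+ 2 + (z.2.1 ^+ 2 + z.2.2 ^+ 2))%R).
have mF1 : measurable_fun setT F1 by rewrite /F1; meas.
have F10 z : (0 <= F1 z)%E by rewrite /F1.
rewrite -[LHS](ge0_integral_lebesgue4 F1 mF1 F10).
rewrite -[LHS]/(\int[(@lebesgue2 R \x @lebesgue2 R)%E]_z F1 z)%E.
rewrite (fubini_tonelli2 F1 mF1 F10) /fubini_G lebesgue2_fubini; last 2 first.
- exact: (measurable_fun_fubini_tonelli_G F1 mF1 F10).
- by move=> u; exact: integral_ge0.
(* Up to the factor [disc_area], [K] is what remains after integrating out b and d, with s = b ^ 2 +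
   d ^ 2. *)
pose K (z : TR * TR) := (\int[mu]_(s in `]0%R, +oo[) f (z.1, (z.2 + s)%R))%E.
have mK : measurable_fun setT K.
  rewrite /K; under eq_fun do rewrite integral_mkcond.
  apply: (@measurable_fun_fubini_tonelli_F _ _ _ _ _ mu
    (fun w : (TR * TR) * TR => ((fun s => f (w.1.1, w.1.2 + s)) \_ `]0, +oo[) w.2)).
    rewrite (_ : (fun _ => _) = fun w : (TR * TR) * TR => if 0 < w.2 then f (w.1.1, w.1.2 + w.2) else 0%E); last first.
      by apply/funext => w; rewrite patchE mem_setE in_itv/= andbT.
    apply: measurable_fun_ifT; [|by meas|by meas].
    by apply: measurable_fun_ltr; meas.
  by move=> w; apply: erestrict_ge0.
have K0 z : (0 <= K z)%E by apply: integral_ge0.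
transitivity (\int[mu]_c \int[mu]_a (disc_area%:E * K ((be * c + al * a)%R, (c ^+ 2 + a ^+ 2)%R)))%E.
  apply: eq_integral => c _.
  pose F2 (z : (TR * TR) * TR) := f ((al * z.1.2 + be * c)%R,
    (z.1.2 ^+ 2 + z.2 ^+ 2 + (c ^+ 2 + z.1.1 ^+ 2))%R).
  have mF2 : measurable_fun setT F2 by rewrite /F2; meas.
  have F20 z : (0 <= F2 z)%E by rewrite /F2.
  transitivity (\int[mu]_d \int[mu]_a \int[mu]_b F2 ((d, a), b))%E.
    apply: eq_integral => d _.
    rewrite (lebesgue2_fubini (fun u => F1 (u, (c, d)))); [|exact: measurable_fun_pair1|by []].
    rewrite (ge0_integral_linear_radial x1 x2 (fun z : TR * TR =>
      f ((z.1 + be * c)%R, (z.2 + (c ^+ 2 + d ^+ 2))%R))); [|by meas|by []].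
    by [].
  (* Exchanging d and a makes d and b the two inner variables, as [ge0_integral_planar] requires. *)
  rewrite (fubini_tonelli (fun z : TR * TR => \int[mu]_b F2 (z, b))%E); last 2 first.
  - exact: (measurable_fun_fubini_tonelli_F F2).
  - by move=> z; exact: integral_ge0.
  apply: eq_integral => a _.
  rewrite /K -(ge0_integral_planar (fun s => f ((be * c + al * a)%R, (c ^+ 2 + a ^+ 2 + s)%R))); [|by meas|by []].
  by apply: eq_integral => d _; apply: eq_integral => b _; rewrite /F2/=; congr f; congr pair; ring.
have area0 : (0 <= disc_area%:E)%E by rewrite lee_fin ltW// disc_area_gt0.
transitivity (disc_area%:E * \int[mu]_c \int[mu]_a K ((be * c + al * a)%R, (c ^+ 2 + a ^+ 2)%R))%E.
  pose F3 (z : TR * TR) := K ((be * z.1 + al * z.2)%R, (z.1 ^+ 2 + z.2 ^+ 2)%R).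
  have mF3 : measurable_fun setT F3 by rewrite /F3; meas.
  rewrite -ge0_integralZl//.
  - apply: eq_integral => c _; rewrite ge0_integralZl//.
    exact: (measurable_fun_pair2 c mF3).
  - by apply: (measurable_fun_fubini_tonelli_F F3 mF3) => z; exact: K0.
  - by move=> c _; exact: integral_ge0.
apply: (congr1 (fun z => disc_area%:E * z)%E).
(* This is where [x] being a unit vector is used. *)
have beal1 : Num.sqrt (be ^+ 2 + al ^+ 2) = 1.
  by rewrite /al /be !sqr_sqrtr ?addr_ge0 ?sqr_ge0// addrC addrA x1E sqrtr1.
have radial := ge0_integral_linear_radial be al K mK K0.
apply: (eq_trans radial); rewrite beal1.
by apply: eq_integral => c _; apply: eq_integral => a _; rewrite mul1r.
Qed.

End zonal_reduction.

(** * One-dimensional integrals *)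

Section calculus.
Context {R : realType}.
Local Notation mu := (@lebesgue_measure R).

(** This rule and the next three are phrased for explicit functions of [y], so that derivatives of
    concrete formulas are assembled by plain application and adjusted at the end by
    [is_derive_eq]. *)
Lemma is_derive_mul {f g : R -> R} {x df dg : R} :
  is_derive x 1 f df -> is_derive x 1 g dg ->
  is_derive x 1 (fun y => f y * g y) (df * g x + f x * dg).
Proof.
move=> hf hg; have h := is_deriveM hf hg.
by apply: is_derive_eq; rewrite /GRing.scale/= addrC (mulrC _ df).
Qed.

Lemma is_derive_add {f g : R -> R} {x df dg : R} :
  is_derive x 1 f df -> is_derive x 1 g dg ->
  is_derive x 1 (fun y => f y + g y) (df + dg).
Proof. by move=> hf hg; exact: is_deriveD. Qed.

Lemma is_derive_opp {f : R -> R} {x df : R} :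
  is_derive x 1 f df -> is_derive x 1 (fun y => - f y) (- df).
Proof. by move=> hf; exact: is_deriveN. Qed.

Lemma is_derive_comp {f g : R -> R} {x df dg : R} :
  is_derive x 1 g dg -> is_derive (g x) 1 f df ->
  is_derive x 1 (fun y => f (g y)) (df * dg).
Proof. by move=> hg hf; exact: (@is_derive1_comp R f g x df dg hf hg). Qed.

(** Since [ln] is 0 on nonpositive reals, this is the extension of x ln x by 0, which is continuous
    on the whole line. *)
Definition xlnx (x : R) : R := x * ln x.

(** For 0 < x < 1, - ln x = 2 ln (1 / sqrt x) <= 2 / sqrt x. The bound squeezes [xlnx] to 0 at the
    origin. *)
Lemma xlnx_le_sqrt (x : R) : x < 1 -> `|xlnx x| <= 2 * Num.sqrt x.
Proof.
move=> x1; rewrite /xlnx; have [x0|x0] := leP x 0.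
  by rewrite ln0// mulr0 normr0 mulr_ge0// sqrtr_ge0.
have r0 : 0 < Num.sqrt x by rewrite sqrtr_gt0.
have xr : x = Num.sqrt x ^+ 2 by rewrite sqr_sqrtr// ltW.
have lnr : - ln x <= 2 * (Num.sqrt x)^-1.
  rewrite {1}xr (_ : ln (_ ^+ 2) = 2 * ln (Num.sqrt x)); last by rewrite lnXn// mulr_natl.
  rewrite -mulrN ler_pM2l// -lnV ?posrE//.
  by apply/ltW/ln_sublinear; rewrite invr_gt0.
rewrite normrM gtr0_norm// ler0_norm; last by rewrite ln_le0// ltW.
apply: (le_trans (ler_wpM2l (ltW x0) lnr)).
by rewrite {1}xr mulrCA expr2 mulfK ?gt_eqF.
Qed.

Lemma continuous_xlnx : continuous xlnx.
Proof.
move=> x; have [x0|x0|->] := ltgtP x 0.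
- apply: (@near_cst_continuous _ _ 0); near=> y; rewrite /xlnx ln0 ?mulr0//.
  by apply: ltW; near: y; exact: lt_nbhsl.
- have id_ln := cvgM (@cvg_id _ (nbhs x)) (continuous_ln x0).
  exact: id_ln.
- have two_sqrt : 2 * Num.sqrt y @[y --> (0 : R)] --> (0 : R).
    suff : 2 * Num.sqrt y @[y --> (0 : R)] --> (2 * Num.sqrt 0 : R) by rewrite sqrtr0 mulr0.
    by apply: cvgM; [exact: cvg_cst|exact: sqrt_continuous].
  have two_sqrtN : - (2 * Num.sqrt y) @[y --> (0 : R)] --> (0 : R).
    by have := cvgN two_sqrt; rewrite oppr0; apply.
  rewrite /continuous_at /xlnx mul0r.
  apply: (squeeze_cvgr _ two_sqrtN two_sqrt).
  near=> y; rewrite -ler_norml; apply: xlnx_le_sqrt.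
  by near: y; exact: (lt_nbhsl ltr01).
Unshelve. all: by end_near. Qed.

Lemma is_derive_xlnx {x : R} : 0 < x -> is_derive x 1 xlnx (ln x + 1).
Proof.
move=> x0; have := is_derive_mul (is_derive_id x 1) (is_derive1_ln x0).
by rewrite mul1r mulfV ?gt_eqF.
Qed.

(** The derivative of [F] is required only in the open interval: the antiderivatives below are built
    from [xlnx], which is continuous but not differentiable at 0. *)
Lemma integral_itv_FTC (a b : R) (b0 b1 : bool) (f F : R -> R) : a < b ->
    {in `[a, b], continuous f} -> measurable_fun setT f -> continuous F ->
    (forall x, a < x < b -> is_derive x 1 F (f x)) ->
  (\int[mu]_(x in [set` Interval (BSide b0 a) (BSide b1 b)]) (f x)%:E =
   (F b - F a)%:E)%E.
Proof.
move=> ab cf mf cF dF.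
have mEf D : measurable_fun D (EFin \o f) by exact/measurable_EFinP/measurable_funTS.
rewrite integral_itv_bndoo// -(@integral_itv_bndoo _ a b _ true false)//.
rewrite (@continuous_FTC2 _ f F a b ab) ?EFinB//.
- by apply: continuous_in_subspaceT => x; rewrite inE; exact: cf.
- split.
  + by move=> x; rewrite in_itv/= => /dF [].
  + by apply: cvg_at_right_filter; exact: cF.
  + by apply: cvg_at_left_filter; exact: cF.
- by move=> x; rewrite in_itv/= => /dF dx; rewrite derive1E; apply: derive_val.
Qed.

Lemma measurable_xlnx : measurable_fun setT xlnx.
Proof. by apply: continuous_measurable_fun; exact: continuous_xlnx. Qed.

Lemma integral_idfun01 : (\int[mu]_(x in `]0%R, 1%R]) x%:E = (2^-1)%:E)%E.
Proof.
have dF (x : R) : 0 < x < 1 -> is_derive x 1 (fun x => x * x * 2^-1) (id x).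
  move=> _; have d := is_derive_mul (is_derive_mul (is_derive_id x 1) (is_derive_id x 1))
    (is_derive_cst (2^-1 : R) x 1).
  by apply: (is_derive_eq d) => /=; field.
rewrite (integral_itv_FTC 0 1 false false id _ ltr01 _ _ _ dF).
- by congr EFin; field.
- by move=> x _; exact: cvg_id.
- exact: measurable_id.
- by move=> x; apply: cvgM; [apply: cvgM; exact: cvg_id | exact: cvg_cst].
Qed.

Let N11 : (-1 : R) < 1. Proof. by lra. Qed.

Lemma integral_onem_sqr :
  (\int[mu]_(q in `](-1)%R, 1%R[) (1 - q * q)%:E = (4 / 3)%:E)%E.
Proof.
have dF (q : R) : -1 < q < 1 -> is_derive q 1 (fun q => q + - (q * q * q * 3^-1)) (1 - q * q).
  move=> _; have d := is_derive_add (is_derive_id q 1) (is_derive_opp (is_derive_mul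
    (is_derive_mul (is_derive_mul (is_derive_id q 1) (is_derive_id q 1)) (is_derive_id q 1))
    (is_derive_cst (3^-1 : R) q 1))).
  by apply: (is_derive_eq d) => /=; field.
rewrite (integral_itv_FTC (-1) 1 false true (fun q => 1 - q * q) _ _ _ _ _ dF).
- by congr EFin; field.
- exact: N11.
- by move=> x _; apply: cvgB; [exact: cvg_cst | apply: cvgM; exact: cvg_id].
- by apply: measurable_funB; [exact: measurable_cst | apply: measurable_funM; exact: measurable_id].
- move=> x; apply: cvgD; first exact: cvg_id. apply: cvgN; apply: cvgM; last exact: cvg_cst.
  by apply: cvgM; [apply: cvgM|]; exact: cvg_id.
Qed.

(* With z = 1 + q, an antiderivative of (2 z - z ^ 2) ln z is
   z ^ 2 ln z - z ^ 2 / 2 - z ^ 3 ln z / 3 + z ^ 3 / 9. *)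
Lemma integral_onem_sqr_ln :
  (\int[mu]_(q in `](-1)%R, 1%R[) ((1 - q * q) * - ln (1 - q * q))%:E =
   (20 / 9 - 8 / 3 * ln 2)%:E)%E.
Proof.
pose h z : R := z * xlnx z + - (z * z * 2^-1) + - (z * z * xlnx z * 3^-1) + z * z * z * 9^-1.
have dh (z : R) : 0 < z -> is_derive z 1 h ((2 - z) * xlnx z).
  move=> z0; have i := is_derive_id z (1 : R); have zz := is_derive_mul i i.
  have l := is_derive_xlnx z0.
  have d := is_derive_add (is_derive_add (is_derive_add (is_derive_mul i l)
    (is_derive_opp (is_derive_mul zz (is_derive_cst (2^-1 : R) z 1))))
    (is_derive_opp (is_derive_mul (is_derive_mul zz l) (is_derive_cst (3^-1 : R) z 1))))
    (is_derive_mul (is_derive_mul zz i) (is_derive_cst (9^-1 : R) z 1)).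
  by apply: (is_derive_eq d); rewrite /xlnx/=; field.
have ch : continuous h.
  have ci : continuous (@id R) by move=> x; exact: cvg_id.
  move=> z; rewrite /continuous_at /h.
  by do ![exact: ci | exact: cvg_cst | exact: continuous_xlnx | apply: cvgD | apply: cvgN | apply: cvgM].
have c1D : continuous (fun q : R => 1 + q).
  by move=> q; apply: cvgD; [exact: cvg_cst | exact: cvg_id].
have c1B : continuous (fun q : R => 1 + - q).
  by move=> q; apply: cvgD; [exact: cvg_cst | apply: cvgN; exact: cvg_id].
(* Factoring 1 - q ^ 2 = (1 + q) (1 - q) splits the logarithm; each half is covered by [h], at z = 1
   + q and at z = 1 - q. *)
pose f q : R := - ((1 - q) * xlnx (1 + q)) + - ((1 + q) * xlnx (1 + - q)).
have dF (q : R) : -1 < q < 1 -> is_derive q 1 (fun q => - h (1 + q) + h (1 + - q)) (f q).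
  move=> /andP[q1 q2]; have i := is_derive_id q (1 : R); have c := is_derive_cst (1 : R) q (1 : R).
  have p0 : 0 < 1 + q by lra.
  have n0 : 0 < 1 + - q by lra.
  have d := is_derive_add
    (is_derive_opp (is_derive_comp (is_derive_add c i) (dh _ p0)))
    (is_derive_comp (is_derive_add c (is_derive_opp i)) (dh _ n0)).
  by apply: (is_derive_eq d); rewrite /f/=; ring.
have cf : continuous f.
  move=> q; rewrite /continuous_at /f.
  have e1 := continuous_comp (c1D q) (continuous_xlnx (1 + q)).
  have e2 := continuous_comp (c1B q) (continuous_xlnx (1 + - q)).
  apply: cvgD; apply: cvgN; apply: cvgM; [exact: c1B|exact: e1|exact: c1D|exact: e2].
transitivity (\int[mu]_(q in `](-1)%R, 1%R[) (f q)%:E)%E.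
  apply: eq_integral => q; rewrite inE/= in_itv/= => /andP[q1 q2].
  rewrite /f /xlnx (_ : 1 - q * q = (1 + q) * (1 + - q)); last by ring.
  rewrite lnM ?posrE; [|lra|lra].
  by congr EFin; ring.
rewrite (integral_itv_FTC (-1) 1 false true f _ _ _ _ _ dF).
- congr EFin; rewrite /h /xlnx !(subrr, opprK) !mul0r. by field.
- exact: N11.
- by move=> x _; exact: cf.
- by apply: continuous_measurable_fun.
- move=> q; have e1 := continuous_comp (c1D q) (ch (1 + q)).
  have e2 := continuous_comp (c1B q) (ch (1 + - q)).
  apply: cvgD; first by apply: cvgN; exact: e1.
  exact: e2.
Qed.

(** With c = b ^ 2 this is the radial integral over the slice of the 3-ball at height b. *)
Lemma integral_Nln_onem (c : R) : 0 < c < 1 ->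
  (\int[mu]_(s in `]0%R, (1 - c)%R[) (- ln (1 + - s))%:E = (1 - c + xlnx c)%:E)%E.
Proof.
move=> /andP[c0 c1].
have c1B : continuous (fun q : R => 1 + - q).
  by move=> q; apply: cvgD; [exact: cvg_cst | apply: cvgN; exact: cvg_id].
have dF (s : R) : 0 < s < 1 - c -> is_derive s 1 (fun s => s + xlnx (1 + - s)) (- ln (1 + - s)).
  move=> /andP[s0 s1]; have i := is_derive_id s (1 : R).
  have p0 : 0 < 1 + - s by lra.
  have d := is_derive_add i (is_derive_comp (is_derive_add (is_derive_cst (1 : R) s (1 : R))
    (is_derive_opp i)) (is_derive_xlnx p0)).
  by apply: (is_derive_eq d) => /=; ring.
rewrite (integral_itv_FTC 0 (1 - c) false true (fun s => - ln (1 + - s)) _ _ _ _ _ dF).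
- by congr EFin; rewrite subr0 /xlnx ln1 mulr0 opprB addrCA subrr addr0; ring.
- by rewrite subr_gt0.
- move=> s; rewrite in_itv/= => /andP[s0 s1].
  have p0 : 0 < 1 + - s by apply: (lt_le_trans c0); lra.
  by apply: cvgN; exact: (continuous_comp (c1B s) (continuous_ln p0)).
- apply: measurableT_comp; first exact: oppr_measurable.
  by apply: measurableT_comp; [exact: measurable_ln | exact: continuous_measurable_fun].
- move=> s; apply: cvgD; first exact: cvg_id.
  exact: (continuous_comp (c1B s) (continuous_xlnx (1 + - s))).
Qed.

(** Multiply ln (1 / c) <= 1 / c - 1 by c. It makes [1 - b * b + xlnx (b * b)] nonnegative. *)
Lemma xlnx_ge (c : R) : 0 <= c -> c - 1 <= xlnx c.
Proof.
rewrite le_eqVlt => /predU1P[<-|c0]; first by rewrite /xlnx ln0// mulr0; lra.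
have : ln c^-1 <= c^-1 - 1.
  have cV0 : 0 < c^-1 by rewrite invr_gt0.
  rewrite {1}(_ : c^-1 = 1 + (c^-1 - 1)); last by ring.
  by apply: le_ln1Dx; lra.
rewrite -(ler_pM2l c0) lnV ?posrE// mulrBr mulfV ?gt_eqF// /xlnx mulrN mulr1; lra.
Qed.

Lemma integral_onem_sqr_xlnx :
  (\int[mu]_(b in `](-1)%R, 1%R[) (1 - b * b + xlnx (b * b))%:E = (8 / 9)%:E)%E.
Proof.
pose f (b : R) : R := 1 - b * b + xlnx (b * b).
(* The coefficient 5 / 9 is 1 / 3 from - b ^ 2 plus 2 / 9 from integrating b ^ 2 ln (b ^ 2) by
   parts. *)
pose F (b : R) : R := b + - (b * b * b * (5 / 9)) + b * xlnx (b * b) * 3^-1.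
have ci : continuous (@id R) by move=> x; exact: cvg_id.
have csq : continuous (fun b : R => b * b) by move=> b; apply: cvgM; exact: ci.
have cx : continuous (fun b : R => xlnx (b * b)).
  by move=> b; exact: (continuous_comp (csq b) (continuous_xlnx (b * b))).
have cf : continuous f.
  move=> b; apply: cvgD; last exact: cx.
  by apply: cvgB; [exact: cvg_cst | exact: csq].
have cF : continuous F.
  move=> b; rewrite /continuous_at /F.
  by do ![exact: ci | exact: cvg_cst | exact: cx | apply: cvgD | apply: cvgN | apply: cvgM].
have mf : measurable_fun setT f by exact: continuous_measurable_fun.
have dF (b : R) : b != 0 -> is_derive b 1 F (f b).
  move=> b0; have i := is_derive_id b (1 : R); have ii := is_derive_mul i i.
  have bb0 : 0 < b * b by rewrite -expr2 exprn_even_gt0.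
  have d := is_derive_add
    (is_derive_add i (is_derive_opp (is_derive_mul (is_derive_mul ii i) (is_derive_cst (5 / 9 : R) b 1))))
    (is_derive_mul (is_derive_mul i (is_derive_comp ii (is_derive_xlnx bb0))) (is_derive_cst (3^-1 : R) b 1)).
  by apply: (is_derive_eq d); rewrite /f /xlnx /=; field.
have dFneg (b : R) : -1 < b < 0 -> is_derive b 1 F (f b).
  by move=> /andP[_ b0]; apply: dF; rewrite lt_eqF.
have dFpos (b : R) : 0 < b < 1 -> is_derive b 1 F (f b).
  by move=> /andP[b0 _]; apply: dF; rewrite gt_eqF.
(* The derivative of [F] is available only for b != 0, hence the cut at 0. *)
rewrite (@itv_bndbnd_setU _ _ _ (BLeft 0)) ?bnd_simp//.
rewrite ge0_integral_setU//=.
- rewrite (integral_itv_FTC (-1) 0 false true f F _ _ mf cF dFneg); last 2 first.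
  + by lra.
  + by move=> *; exact: cf.
  rewrite (integral_itv_FTC 0 1 true true f F _ _ mf cF dFpos); last 2 first.
  + by lra.
  + by move=> *; exact: cf.
  rewrite -EFinD; congr EFin.
  by rewrite /F /xlnx !(mul0r, mulrN1, opprK, mul1r, mulr1, mulr0) ln1 !(mulr0, mul0r); field.
- by apply/measurable_EFinP; exact: measurable_funTS.
- by move=> b _; rewrite lee_fin; have := @xlnx_ge (b * b); rewrite -expr2 sqr_ge0 => /(_ isT); lra.
- rewrite disj_set2E; apply/eqP/seteqP; split => // b []/=; rewrite !in_itv/= => /andP[_ b0] /andP[].
  by rewrite leNgt b0.
Qed.

End calculus.

(** * From the reduced 4-ball integral to the unit disc *)

Section ball_slices.
Context {R : realType}.
Local Notation TR := (measurableTypeR R).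
Local Notation mu := (@lebesgue_measure R).
Local Notation disc_area := (@disc_area R).

Definition disc_integral (phi : TR -> \bar R) : \bar R :=
  (\int[mu]_a \int[mu]_b if (a ^+ 2 + b ^+ 2 < 1)%R then phi a else 0)%E.

Lemma integral_disc_scale (phi : TR -> \bar R) (rho : R) : 0 < rho ->
    measurable_fun setT phi -> (forall x, (0 <= phi x)%E) ->
  (\int[mu]_a \int[mu]_b
     (if (a ^+ 2 + b ^+ 2 < rho)%R then phi (a / Num.sqrt rho)%R else 0) =
   rho%:E * disc_integral phi)%E.
Proof.
move=> rho0 mphi phi0; pose r := Num.sqrt rho.
have r0 : 0 < r by rewrite sqrtr_gt0.
have r2 : r ^+ 2 = rho by rewrite sqr_sqrtr// ltW.
pose F (z : TR * TR) := if z.1 ^+ 2 + z.2 ^+ 2 < rho then phi (z.1 / r) else 0%E.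
have mF : measurable_fun setT F.
  rewrite /F; apply: measurable_fun_ifT; [|by meas|by meas].
  by apply: measurable_fun_ltr; meas.
have F0 z : (0 <= F z)%E by rewrite /F; case: ifP.
rewrite -[LHS](ge0_integral_scale2 r F r0 mF F0) r2; apply: (congr1 (fun z => rho%:E * z)%E).
apply: eq_integral => x _; apply: eq_integral => y _; rewrite /F/=.
rewrite !exprMn r2 -mulrDr -{2}(mulr1 rho) ltr_pM2l// (mulrC r) mulfK//.
by rewrite gt_eqF.
Qed.

(** Substitute rho = a ^ 2 + b ^ 2 + s and integrate over rho last. For fixed rho the pair (a, b)
    fills the disc of squared radius rho, which rescales to the unit disc with factor rho; the
    integral of rho over ]0, 1] is 1 / 2. *)
Lemma integral_ball_slices (phi : TR -> \bar R) :
    measurable_fun setT phi -> (forall x, (0 <= phi x)%E) ->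
  (\int[mu]_a \int[mu]_b \int[mu]_(s in `]0%R, +oo[)
     (if (0 < a ^+ 2 + b ^+ 2 + s <= 1)%R
      then phi (a / Num.sqrt (a ^+ 2 + b ^+ 2 + s))%R else 0) =
   (2^-1)%:E * disc_integral phi)%E.
Proof.
move=> mphi phi0.
pose F (w : (TR * TR) * TR) := if w.1.1 ^+ 2 + w.1.2 ^+ 2 < w.2 then
  (if 0 < w.2 <= 1 then phi (w.1.1 / Num.sqrt w.2) else 0%E) else 0%E.
have mF : measurable_fun setT F.
  rewrite /F; apply: measurable_fun_ifT; [|apply: measurable_fun_ifT; last by meas|by meas].
  - by apply: measurable_fun_ltr; meas.
  - apply: measurable_and; last by apply: measurable_fun_ler; meas.
    by apply: measurable_fun_ltr; meas.
  - apply: measurableT_comp mphi _; apply: measurable_funM; first by meas.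
    apply: measurableT_comp; first exact: measurable_invr.
    by apply: measurableT_comp; [exact: measurable_sqrtr | exact: measurable_snd].
have F0 w : (0 <= F w)%E by rewrite /F; case: ifP => // _; case: ifP.
transitivity (\int[mu]_a \int[mu]_b \int[mu]_rho F ((a, b), rho))%E.
  apply: eq_integral => a _; apply: eq_integral => b _.
  rewrite -(ge0_integral_translation (a ^+ 2 + b ^+ 2) (fun rho => F ((a, b), rho))); last 2 first.
  - exact: measurable_fun_pair2.
  - by [].
  rewrite integral_mkcond; apply: eq_integral => s _.
  rewrite patchE mem_setE in_itv/= andbT /F /= ltrDr.
  by rewrite (addrC s).
have mFF := measurable_fun_fubini_tonelli_F F mF F0 (m2 := mu).
rewrite -(lebesgue2_fubini (fun z => \int[mu]_rho F (z, rho))%E mFF); last first.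
  by move=> z; exact: integral_ge0.
rewrite (@fubini_tonelli _ _ _ _ _ (@lebesgue2 R) mu F mF F0).
have I0 : (0 <= disc_integral phi)%E.
  by apply: integral_ge0 => a _; apply: integral_ge0 => b _; case: ifP.
transitivity (\int[mu]_rho ((if 0 < rho <= 1 then rho else 0)%:E * disc_integral phi))%E.
  apply: eq_integral => rho _.
  rewrite (lebesgue2_fubini (fun z => F (z, rho))); last 2 first.
  - exact: measurable_fun_pair1.
  - by [].
  case: ifPn => [/[dup] rho01 /andP[rho0 _]|rho01].
    rewrite -(integral_disc_scale phi rho rho0 mphi phi0); apply: eq_integral => a _; apply: eq_integral => b _.
    by rewrite /F/= rho01.
  rewrite mul0e; apply: integral0_eq => a _; apply: integral0_eq => b _.
  by rewrite /F/= (negbTE rho01) if_same.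
rewrite ge0_integralZr//; last 2 first.
- apply/measurable_EFinP; apply: measurable_fun_ifT; last 2 first.
  + exact: measurable_id.
  + exact: measurable_cst.
  + apply: measurable_and; last by apply: measurable_fun_ler; meas.
    by apply: measurable_fun_ltr; meas.
- by move=> rho _; rewrite lee_fin; case: ifP => // /andP[/ltW].
apply: (congr1 (fun z => z * disc_integral phi)%E).
transitivity (\int[mu]_(x in `]0%R, 1%R]) x%:E)%E.
  rewrite [RHS]integral_mkcond; apply: eq_integral => x _.
  by rewrite patchE mem_setE in_itv/=; case: ifP.
exact: integral_idfun01.
Qed.

End ball_slices.

(** * The logarithmic integral over the disc *)

Section disc_integrals.
Context {R : realType}.
Local Notation TR := (measurableTypeR R).
Local Notation mu := (@lebesgue_measure R).
Local Notation disc_area := (@disc_area R).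

(** The value +oo for t = 1 and t = -1 agrees with the infinite energy of coinciding points, so the
    energy identity below holds everywhere on the sphere and not just almost everywhere. *)
Definition neg_log_onem_sqr (t : TR) : \bar R :=
  if t ^+ 2 < 1 then (- ln (1 - t ^+ 2))%:E else +oo%E.

Lemma measurable_neg_log_onem_sqr : measurable_fun setT neg_log_onem_sqr.
Proof.
apply: measurable_fun_ifT; [by apply: measurable_fun_ltr; meas| |by meas].
apply/measurable_EFinP; apply: measurableT_comp; first exact: oppr_measurable.
apply: measurableT_comp; first exact: measurable_ln.
by apply: measurable_funB; meas.
Qed.

Lemma neg_log_onem_sqr_ge0 t : (0 <= neg_log_onem_sqr t)%E.
Proof.
rewrite /neg_log_onem_sqr; case: ifPn => // t1.
by rewrite lee_fin oppr_ge0 ln_le0// lerBlDr lerDl sqr_ge0.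
Qed.

Lemma measurable_disc_if (phi : TR -> \bar R) (e : R) : measurable_fun setT phi ->
  measurable_fun setT (fun z : TR * TR => if z.1 ^+ 2 + z.2 ^+ 2 < e then phi z.1 else 0%E).
Proof.
move=> mphi; apply: measurable_fun_ifT; [|by meas|by meas].
by apply: measurable_fun_ltr; meas.
Qed.

Lemma disc_integralE (phi : TR -> \bar R) :
    measurable_fun setT phi -> (forall x, (0 <= phi x)%E) ->
  disc_integral phi =
  (\int[@lebesgue2 R]_z (if (z.1 ^+ 2 + z.2 ^+ 2 < 1)%R then phi z.1 else 0))%E.
Proof.
move=> mphi phi0.
rewrite (lebesgue2_fubini (fun z => if (z.1 ^+ 2 + z.2 ^+ 2 < 1)%R then phi z.1 else 0)%E).
- by [].
- exact: measurable_disc_if.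
- by move=> z; case: ifP.
Qed.

Lemma disc_integralD (phi psi : TR -> \bar R) :
    measurable_fun setT phi -> (forall x, (0 <= phi x)%E) ->
    measurable_fun setT psi -> (forall x, (0 <= psi x)%E) ->
  (disc_integral (fun t => phi t + psi t) = disc_integral phi + disc_integral psi)%E.
Proof.
move=> mphi phi0 mpsi psi0; rewrite !disc_integralE//.
- rewrite -ge0_integralD//.
  + by apply: eq_integral => z _; case: ifP => // _; rewrite adde0.
  + by move=> z _; case: ifP.
  + exact: measurable_disc_if.
  + by move=> z _; case: ifP.
  + exact: measurable_disc_if.
- exact: emeasurable_funD.
- by move=> x; rewrite adde_ge0.
Qed.

Lemma disc_integral_cst (k : R) : 0 <= k ->
  disc_integral (fun=> k%:E) = (disc_area * k)%:E.
Proof.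
move=> k0; rewrite /disc_integral.
rewrite (ge0_integral_planar (fun s => if s < 1 then k%:E else 0%E)); last 2 first.
- apply: measurable_fun_ifT; [|by meas|by meas].
  by apply: measurable_fun_ltr; meas.
- by move=> s; case: ifP.
rewrite (_ : (\int[mu]_(s in _) _)%E = (\int[mu]_(s in `]0%R, 1%R[) k%:E)%E); last first.
  rewrite integral_mkcond [RHS]integral_mkcond; apply: eq_integral => s _.
  rewrite !patchE !mem_setE !in_itv/= andbT.
  by case: (0 < s) => //=; case: ifP.
rewrite integral_cst//= lebesgue_measure_itv/= lte_fin ltr01 sube0 mule1.
by rewrite EFinM.
Qed.

Lemma sqr_lt1_itv (q : R) : (q ^+ 2 < 1) = (-1 < q < 1).
Proof.
by apply/idP/idP => [h|/andP[h1 h2]]; [apply/andP; split|]; nra.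
Qed.

(** With a = sqrt rho * t, - ln (rho - a ^ 2) = - ln (1 - t ^ 2) - ln rho. The bound [rho <= 1]
    makes both summands nonnegative. *)
Lemma disc_integral_neg_log_scale (rho : R) : 0 < rho <= 1 ->
  (\int[mu]_a \int[mu]_b
     (if (a ^+ 2 + b ^+ 2 < rho)%R then (- ln (rho - a ^+ 2))%:E else 0) =
   rho%:E * disc_integral neg_log_onem_sqr + (disc_area * (rho * - ln rho))%:E)%E.
Proof.
move=> /andP[rho0 rho1].
have lrho : 0 <= - ln rho by rewrite oppr_ge0 ln_le0.
have mf := measurable_neg_log_onem_sqr.
have f0 := neg_log_onem_sqr_ge0.
transitivity (rho%:E * disc_integral (fun t => neg_log_onem_sqr t + (- ln rho)%:E))%E; last first.
  rewrite (disc_integralD neg_log_onem_sqr (fun=> (- ln rho)%:E))//.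
  rewrite disc_integral_cst// ge0_muleDr.
  - by rewrite -EFinM; congr (_ + _%:E)%E; ring.
  - by apply: integral_ge0 => a _; apply: integral_ge0 => b _; case: ifP.
  - by rewrite lee_fin mulr_ge0// ltW// disc_area_gt0.
rewrite -(integral_disc_scale _ rho rho0); last 2 first.
- exact: emeasurable_funD.
- by move=> x; rewrite adde_ge0.
apply: eq_integral => a _; apply: eq_integral => b _; case: ifPn => // ab.
have a2 : a ^+ 2 < rho by apply: le_lt_trans ab; rewrite lerDl sqr_ge0.
have ar : (a / Num.sqrt rho) ^+ 2 = a ^+ 2 / rho.
  by rewrite expr_div_n sqr_sqrtr// ltW.
rewrite /neg_log_onem_sqr ar ltr_pdivrMr// mul1r a2 -EFinD; congr EFin.
rewrite -opprD -lnM ?posrE//.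
  by congr (- ln _); field; rewrite gt_eqF.
by rewrite subr_gt0 ltr_pdivrMr// mul1r.
Qed.

End disc_integrals.

(** * The 3-ball integral along two slicings *)

Section disc_log_value.
Context {R : realType}.
Local Notation TR := (measurableTypeR R).
Local Notation mu := (@lebesgue_measure R).
Local Notation disc_area := (@disc_area R).

(** The coordinates are w = ((q, a), b), so [K] below integrates over the slice at height b. *)
Let F (w : (TR * TR) * TR) : \bar R :=
  if w.1.1 ^+ 2 + w.1.2 ^+ 2 + w.2 ^+ 2 < 1
  then (- ln (1 - (w.1.1 ^+ 2 + w.1.2 ^+ 2)))%:E else 0%E.

Let mF : measurable_fun setT F.
Proof.
apply: measurable_fun_ifT; [by apply: measurable_fun_ltr; meas| |by meas].
apply/measurable_EFinP; apply: measurableT_comp; first exact: oppr_measurable.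
apply: measurableT_comp; first exact: measurable_ln.
by meas.
Qed.

Let F0 w : (0 <= F w)%E.
Proof.
rewrite /F; case: ifP => // _.
by rewrite lee_fin oppr_ge0 ln_le0// lerBlDr lerDl addr_ge0 ?sqr_ge0.
Qed.

Let K (b : TR) : \bar R := (\int[@lebesgue2 R]_z F (z, b))%E.

Let mK : measurable_fun setT K.
Proof. exact: (measurable_fun_fubini_tonelli_G F). Qed.

Let K_eq0 b : 1 <= b ^+ 2 -> K b = 0%E.
Proof.
move=> b1; apply: integral0_eq => z _; rewrite /F/= ifF//; apply/negbTE.
by rewrite -leNgt (le_trans b1)// lerDr addr_ge0 ?sqr_ge0.
Qed.

(** On this slice the integrand depends only on s = q ^ 2 + a ^ 2, which ranges over [0, 1 - b ^
    2[. *)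
Let KE b : 0 < b ^+ 2 < 1 -> K b = (disc_area * (1 - b * b + xlnx (b * b)))%:E.
Proof.
move=> b01; rewrite /K (lebesgue2_fubini (fun z => F (z, b))); last 2 first.
- exact: measurable_fun_pair1.
- by [].
pose G (s : TR) := if 0 <= s < 1 - b ^+ 2 then (- ln (1 + - s))%:E else 0%E.
have mG : measurable_fun setT G.
  apply: measurable_fun_ifT; last by meas.
    by apply: measurable_and; [apply: measurable_fun_ler|apply: measurable_fun_ltr]; meas.
  apply/measurable_EFinP; apply: measurableT_comp; first exact: oppr_measurable.
  apply: measurableT_comp; first exact: measurable_ln.
  by apply: measurable_funB; meas.
have G0 s : (0 <= G s)%E.
  rewrite /G; case: ifP => // /andP[s0 _].
  by rewrite lee_fin oppr_ge0 ln_le0// lerBlDr lerDl.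
transitivity (\int[mu]_x \int[mu]_y G (x ^+ 2 + y ^+ 2)%R)%E.
  apply: eq_integral => x _; apply: eq_integral => y _.
  by rewrite /F /G/= addr_ge0 ?sqr_ge0//= ltrBrDr.
rewrite (ge0_integral_planar G mG G0).
rewrite (_ : (\int[mu]_(s in _) _)%E =
    (\int[mu]_(s in `]0%R, (1 - b ^+ 2)%R[) (- ln (1 + - s))%:E)%E); last first.
  rewrite integral_mkcond [RHS]integral_mkcond; apply: eq_integral => s _.
  rewrite !patchE !mem_setE !in_itv/= andbT /G.
  by case: ltP => [s0|//]; rewrite (ltW s0)/=; case: ifP.
by rewrite integral_Nln_onem// -EFinM expr2.
Qed.

Let integral_K : (\int[mu]_b K b = (disc_area * (8 / 9))%:E)%E.
Proof.
have mD0 : measurable (`](-1)%R, 1%R[ `\ 0%R : set R) by exact: measurableD.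
(* The point 0, where [KE] says nothing, is removed as a null set and put back once [K] has been
   replaced by its formula. *)
transitivity (\int[mu]_(b in `](-1)%R, 1%R[ `\ 0%R) K b)%E.
  rewrite integral_setD1; [|exact: mD0|by apply: measurable_funTS].
  rewrite [RHS]integral_mkcond; apply: eq_integral => b _.
  rewrite patchE mem_setE in_itv/= -sqr_lt1_itv; case: ltP => // b1.
  exact: K_eq0.
pose f (b : R) := (disc_area%:E * (1 - b * b + xlnx (b * b))%:E)%E.
have mf1 : measurable_fun setT (fun b : TR => (1 - b * b + xlnx (b * b))%:E).
  apply/measurable_EFinP.
  have mx := @measurable_xlnx R.
  apply: measurable_funD; last first.
    by apply: measurableT_comp; [exact: mx|apply: measurable_funM; exact: measurable_id].
  by apply: measurable_funB; [exact: measurable_cst|apply: measurable_funM; exact: measurable_id].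
transitivity (\int[mu]_(b in `](-1)%R, 1%R[ `\ 0%R) f b)%E.
  apply: eq_integral => b; rewrite inE/= in_itv/= -sqr_lt1_itv => -[b1 /eqP b0].
  by rewrite KE ?b1 ?andbT ?exprn_even_gt0// EFinM.
rewrite integral_setD1; [|exact: mD0|by apply: measurable_funTS; exact: measurable_funeM].
rewrite ge0_integralZl//.
- by rewrite integral_onem_sqr_xlnx -EFinM.
- exact: measurable_funTS.
- by move=> b _; rewrite lee_fin; have := @xlnx_ge R (b * b); rewrite -expr2 sqr_ge0 => /(_ isT); lra.
- by rewrite lee_fin ltW// disc_area_gt0.
Qed.

Lemma disc_integral_neg_log :
  disc_integral neg_log_onem_sqr = (disc_area * (2 * ln 2 - 1))%:E.
Proof.
set J := disc_integral _.
have J0 : (0 <= J)%E.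
  apply: integral_ge0 => a _; apply: integral_ge0 => b _.
  by case: ifP => // _; exact: neg_log_onem_sqr_ge0.
have slices : (\int[mu]_b K b = (4 / 3)%:E * J + (disc_area * (20 / 9 - 8 / 3 * ln 2))%:E)%E.
  rewrite -(@fubini_tonelli _ _ _ _ _ (@lebesgue2 R) mu F mF F0).
  have mFF := measurable_fun_fubini_tonelli_F F mF F0 (m2 := mu).
  rewrite (lebesgue2_fubini _ mFF); last by move=> z; exact: integral_ge0.
  (* The slice at q is the disc of squared radius rho = 1 - q ^ 2, and its integrand is - ln (rho -
     a ^ 2). *)
  transitivity (\int[mu]_(q in `](-1)%R, 1%R[)
    ((1 - q * q)%:E * J + disc_area%:E * ((1 - q * q) * - ln (1 - q * q))%:E))%E.
    rewrite [RHS]integral_mkcond; apply: eq_integral => q _.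
    rewrite patchE mem_setE in_itv/= -sqr_lt1_itv; case: ltP => q1.
      rewrite -EFinM -disc_integral_neg_log_scale; last first.
        by rewrite subr_gt0 -expr2 q1 lerBlDr lerDl sqr_ge0.
      apply: eq_integral => a _; apply: eq_integral => b _; rewrite /F/=.
      rewrite -expr2 -addrA ltrBrDl; case: ifP => // _.
      by congr (- ln _)%:E; ring.
    apply: integral0_eq => a _; apply: integral0_eq => b _.
    rewrite /F/= ifF//; apply/negbTE.
    by rewrite -leNgt (le_trans q1)// -addrA lerDl addr_ge0 ?sqr_ge0.
  have q0 (q : R) : q \in `]-1, 1[ -> 0 <= 1 - q * q.
    by rewrite in_itv/= -sqr_lt1_itv -expr2 subr_ge0 => /ltW.
  have mq : measurable_fun setT (fun q : TR => 1 - q * q).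
    by apply: measurable_funB; [exact: measurable_cst|apply: measurable_funM; exact: measurable_id].
  have mql : measurable_fun setT (fun q : TR => (1 - q * q) * - ln (1 - q * q)).
    apply: measurable_funM; first exact: mq.
    apply: measurableT_comp; first exact: oppr_measurable.
    by apply: measurableT_comp; [exact: measurable_ln | exact: mq].
  have ql0 (q : R) : q \in `]-1, 1[ -> 0 <= (1 - q * q) * - ln (1 - q * q).
    move=> /q0 q1; rewrite mulr_ge0// oppr_ge0 ln_le0// lerBlDr lerDl -expr2 sqr_ge0//.
  have area0 := ltW (@disc_area_gt0 R).
  rewrite ge0_integralD//=.
  - rewrite ge0_integralZr//=.
    + rewrite integral_onem_sqr ge0_integralZl//=.
      * by rewrite integral_onem_sqr_ln EFinM.
      * by apply/measurable_EFinP; exact: measurable_funTS.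
    + by apply/measurable_EFinP; exact: measurable_funTS.
  - by move=> q q1; rewrite mule_ge0// lee_fin; exact: q0.
  - apply: emeasurable_funM; last exact: measurable_cst.
    by apply/measurable_EFinP; exact: measurable_funTS.
  - by move=> q q1; rewrite mule_ge0// lee_fin; exact: ql0.
  - apply: emeasurable_funM; first exact: measurable_cst.
    by apply/measurable_EFinP; exact: measurable_funTS.
(* That [J] is finite comes out only here: [J = +oo] would contradict the finite value of the
   left-hand side. Then the linear equation is solved for [J]. *)
move: slices J0; rewrite integral_K; case: J => [j|//|//].
  rewrite -EFinM -EFinD => -[h] _; congr EFin.
  by apply: (@mulfI _ (4 / 3)); [rewrite mulf_neq0 ?invr_eq0 ?pnatr_eq0 | lra].
by rewrite gt0_muley ?lte_fin ?divr_gt0.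
Qed.

End disc_log_value.

(** * The uniform distribution on the sphere *)

Section ball_projection.
Context {R : realType}.
Local Notation TR := (measurableTypeR R).
Local Notation mu := (@lebesgue_measure R).
Local Notation disc_area := (@disc_area R).

Local Notation TR4 := ((TR * TR) * (TR * TR))%type.

Definition sqnorm4 (y : R4 R) : R := y.1.1 ^+ 2 + y.1.2 ^+ 2 + y.2.1 ^+ 2 + y.2.2 ^+ 2.

Definition dot4 (x y : R4 R) : R :=
  x.1.1 * y.1.1 + x.1.2 * y.1.2 + x.2.1 * y.2.1 + x.2.2 * y.2.2.

(** The origin is left out, matching [0 < t] in [cone]. *)
Definition unit_ball : set (R4 R) := [set y | 0 < sqnorm4 y <= 1].

(* Outside the ball the value is 0, which is not on the sphere, so that the
   preimage of the sphere is the ball. *)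
Definition radial_proj (y : R4 R) : R4 R :=
  if 0 < sqnorm4 y <= 1 then (enorm y)^-1 *: y else 0.

Lemma sqnorm4_ge0 y : 0 <= sqnorm4 y.
Proof. by rewrite /sqnorm4 !addr_ge0 ?sqr_ge0. Qed.

Lemma enorm_sqr (y : R4 R) : enorm y ^+ 2 = sqnorm4 y.
Proof. by rewrite sqr_sqrtr// sqnorm4_ge0. Qed.

Lemma enormZ (t : R) (y : R4 R) : 0 <= t -> enorm (t *: y) = t * enorm y.
Proof.
move=> t0; rewrite /enorm.
transitivity (Num.sqrt (t ^+ 2 * sqnorm4 y)).
  congr Num.sqrt; rewrite /sqnorm4.
  transitivity ((t * y.1.1) ^+ 2 + (t * y.1.2) ^+ 2 + (t * y.2.1) ^+ 2 + (t * y.2.2) ^+ 2) => //.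
  by ring.
by rewrite sqrtrM ?sqr_ge0// sqrtr_sqr ger0_norm.
Qed.

Lemma enorm_gt0 (y : R4 R) : (0 < enorm y) = (0 < sqnorm4 y).
Proof. by rewrite /enorm sqrtr_gt0. Qed.

Lemma enorm_radial_proj y : unit_ball y -> enorm (radial_proj y) = 1.
Proof.
move=> By; rewrite /radial_proj By enormZ ?invr_ge0 ?sqrtr_ge0// mulVf//.
by rewrite gt_eqF// enorm_gt0; case/andP: By.
Qed.

Lemma radial_proj_S3 : radial_proj @^-1` @S3 R = unit_ball.
Proof.
apply/seteqP; split => y; last by move=> /enorm_radial_proj.
rewrite /S3 /= /radial_proj /unit_ball/=; case: ifPn => // _.
move=> /(congr1 (fun r => r ^+ 2)); rewrite enorm_sqr /sqnorm4/= expr0n !addr0 expr1n => /eqP.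
by rewrite eq_sym oner_eq0.
Qed.

(** A point of the cone is t x with x on the sphere, so t is its norm and x its radial projection.
    Surface measure thus becomes a pushforward of Lebesgue measure. *)
Lemma cone_sphereI (A : set (R4 R)) :
  cone (A `&` @S3 R) = radial_proj @^-1` (A `&` @S3 R).
Proof.
apply/seteqP; split => y.
  move=> [t [x [t0 t1 [Ax Sx] ->]]].
  have Btx : 0 < sqnorm4 (t *: x) <= 1.
    by rewrite -enorm_sqr (enormZ _ _ (ltW t0)) Sx mulr1 exprn_gt0//= exprn_ile1// ltW.
  have tx : radial_proj (t *: x) = x.
    by rewrite /radial_proj Btx (enormZ _ _ (ltW t0)) Sx mulr1 scalerA mulVf ?scale1r// gt_eqF.
  by rewrite /preimage/= tx.
move=> ASy; have : (radial_proj @^-1` @S3 R) y by case: ASy.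
rewrite radial_proj_S3 => /[dup] By /andP[y0 y1].
exists (enorm y), (radial_proj y); split => //.
- by rewrite enorm_gt0.
- by rewrite -(@ler_pXn2r _ 2) ?nnegrE ?sqrtr_ge0// enorm_sqr expr1n.
- by rewrite /radial_proj By scalerA divff ?scale1r// gt_eqF// enorm_gt0.
Qed.

Lemma measurable_sqnorm4 : measurable_fun setT (sqnorm4 : TR4 -> TR).
Proof. by rewrite /sqnorm4; meas. Qed.

Lemma measurable_unit_ball_bool :
  measurable_fun setT (fun y : TR4 => 0 < sqnorm4 y <= 1).
Proof.
have msq := measurable_sqnorm4.
by apply: measurable_and; [apply: measurable_fun_ltr|apply: measurable_fun_ler]; meas.
Qed.

Lemma measurable_unit_ball : measurable (unit_ball : set TR4).
Proof.
rewrite -[X in measurable X]setTI (_ : unit_ball = (fun y : TR4 => 0 < sqnorm4 y <= 1) @^-1` [set true])//.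
exact: measurable_unit_ball_bool.
Qed.

Lemma measurable_radial_proj : measurable_fun setT (radial_proj : TR4 -> R4 R).
Proof.
apply: measurable_fun_ifT; [exact: measurable_unit_ball_bool| |exact: measurable_cst].
have men : measurable_fun setT (fun y : TR4 => (enorm y)^-1 : TR).
  apply: measurableT_comp; first exact: measurable_invr.
  by apply: measurableT_comp; [exact: measurable_sqrtr|exact: measurable_sqnorm4].
rewrite (_ : (fun _ => _) = fun y : TR4 =>
  (((enorm y)^-1 * y.1.1, (enorm y)^-1 * y.1.2), ((enorm y)^-1 * y.2.1, (enorm y)^-1 * y.2.2))) //.
by meas.
Qed.

End ball_projection.

Section uniform_average.
Context {R : realType}.
Local Notation TR := (measurableTypeR R).
Local Notation mu := (@lebesgue_measure R).
Local Notation disc_area := (@disc_area R).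

Local Notation TR4 := ((TR * TR) * (TR * TR))%type.

Lemma ge0_integral_ball_zonal (x : R4 R) (phi : TR -> \bar R) : S3 x ->
    measurable_fun setT phi -> (forall t, (0 <= phi t)%E) ->
  (\int[@lebesgue4 R]_(y in @unit_ball R) phi (dot4 x (radial_proj y)) =
   (disc_area / 2)%:E * disc_integral phi)%E.
Proof.
move=> Sx mphi phi0.
(* On the ball the inner product of [x] with the projection of y is that of [x] with y divided by
   the norm of y, hence a function of a linear form and the squared norm. *)
pose f (z : TR * TR) := if 0 < z.2 <= 1 then phi (z.1 / Num.sqrt z.2) else 0%E.
have mf : measurable_fun setT f.
  apply: measurable_fun_ifT; last by meas.
    by apply: measurable_and; [apply: measurable_fun_ltr|apply: measurable_fun_ler]; meas.
  apply: measurableT_comp mphi _; apply: measurable_funM; first by meas.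
  apply: measurableT_comp; first exact: measurable_invr.
  by apply: measurableT_comp; [exact: measurable_sqrtr | exact: measurable_snd].
have f0 z : (0 <= f z)%E by rewrite /f; case: ifP.
have x1 : x.1.1 ^+ 2 + x.1.2 ^+ 2 + x.2.1 ^+ 2 + x.2.2 ^+ 2 = 1.
  by rewrite -[LHS]/(sqnorm4 x) -enorm_sqr Sx expr1n.
transitivity (\int[@lebesgue4 R]_y f (dot4 x y, sqnorm4 y))%E.
  rewrite integral_mkcond; apply: eq_integral => y _; rewrite patchE /f /=.
  case: ifPn => By; last first.
    by rewrite ifF//; apply/negbTE; apply: contra By => By; rewrite inE.
  have {}By : 0 < sqnorm4 y <= 1 by move: By; rewrite inE.
  rewrite By /radial_proj By; congr phi.
  transitivity ((enorm y)^-1 * dot4 x y); last by rewrite mulrC.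
  transitivity (x.1.1 * ((enorm y)^-1 * y.1.1) + x.1.2 * ((enorm y)^-1 * y.1.2) +
     x.2.1 * ((enorm y)^-1 * y.2.1) + x.2.2 * ((enorm y)^-1 * y.2.2)) => //.
  by rewrite /dot4; ring.
have area0 : 0 <= disc_area by rewrite ltW// disc_area_gt0.
rewrite (ge0_integral4_linear_radial x f x1 mf f0) EFinM -muleA.
apply: (congr1 (fun z => disc_area%:E * z)%E).
exact: (integral_ball_slices phi mphi phi0).
Qed.

(** The volume pi ^ 2 / 2 of the unit 4-ball. *)
Definition ball_volume : R := disc_area ^+ 2 / 2.

Lemma ball_volume_gt0 : 0 < ball_volume.
Proof. by rewrite divr_gt0// exprn_gt0// disc_area_gt0. Qed.

(** The zonal formula for the constant function 1, with [e1] as an arbitrary pole. *)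
Lemma lebesgue4_unit_ball : lebesgue4 (@unit_ball R) = ball_volume%:E.
Proof.
pose e1 : R4 R := ((1, 0), (0, 0)).
have Se1 : S3 e1.
  by rewrite /S3/= /enorm/= expr1n !expr0n/= !addr0 sqrtr1.
have := ge0_integral_ball_zonal e1 (fun=> 1%E) Se1 (measurable_cst _) (fun=> lee01).
rewrite disc_integral_cst ?ler01// integral_cst; last exact: measurable_unit_ball.
rewrite mul1e => ->; rewrite -EFinM; congr EFin.
by rewrite /ball_volume; field.
Qed.

Lemma measurable_S3 : measurable (@S3 R).
Proof.
have mS : measurable (@S3 R : set TR4).
  rewrite -[X in measurable X]setTI.
  have men : measurable_fun setT (@enorm R : TR4 -> TR).
    by apply: measurableT_comp; [exact: measurable_sqrtr|exact: measurable_sqnorm4].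
  have -> : @S3 R = @enorm R @^-1` [set 1] by [].
  by apply: men => //; exact: measurable_set1.
exact: mS.
Qed.

Lemma normalized_surface_measureE (A : set (R4 R)) : A `<=` @S3 R ->
  normalized_surface_measure A =
  ((ball_volume^-1)%:E * lebesgue4 (@radial_proj R @^-1` A))%E.
Proof.
move=> AS; rewrite /normalized_surface_measure /surface_measure.
have V0 := ball_volume_gt0.
rewrite !cone_sphereI setIid (setIidl AS) radial_proj_S3 lebesgue4_unit_ball -EFinM inver mulf_eq0 pnatr_eq0/= gt_eqF//.
rewrite (muleC 4%:E) -muleA muleC -EFinM; congr (_%:E * _)%E.
by field; rewrite gt_eqF.
Qed.

Lemma ge0_expectation_uniform d (T : measurableType d) (P : probability T R)
    (X : {RV P >-> R4 R}) (f : R4 R -> \bar R) : uniform_on_S3 X ->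
    measurable_fun setT f -> (forall x, (0 <= f x)%E) ->
  (\int[P]_w f (X w) =
   (ball_volume^-1)%:E * \int[@lebesgue4 R]_(y in @unit_ball R) f (radial_proj y))%E.
Proof.
move=> [XS Xunif] mf f0.
have k0 : 0 <= ball_volume^-1 by rewrite invr_ge0 ltW// ball_volume_gt0.
pose p : {measure set (R4 R) -> \bar R} :=
  measure_function_pushforward__canonical__measure_function_Measure (@lebesgue4 R) (@measurable_radial_proj R).
pose m : {measure set (R4 R) -> \bar R} := mscale (NngNum k0) p.
have mS := measurable_S3.
have mfS : measurable_fun (@S3 R) f by exact: measurable_funTS.
(* The integral is restricted to the sphere, which carries the law of [X], because the pushforward
   formula for the surface measure concerns subsets of the sphere. *)
transitivity (\int[distribution P X]_(x in @S3 R) f x)%E.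
  rewrite ge0_integral_pushforward//.
    rewrite (_ : X @^-1` @S3 R = setT)//.
    by apply/seteqP; split => // w _; exact: XS.
rewrite (eq_measure_integral m) => [|A mA AS]; last first.
  exact: (eq_trans (Xunif A mA) (normalized_surface_measureE A AS)).
rewrite ge0_integral_mscale//.
rewrite (@ge0_integral_pushforward _ _ _ _ _ _ (@measurable_radial_proj R) _ _ _ mS mfS)//.
by rewrite radial_proj_S3.
Qed.

End uniform_average.

(** * Expectations over pairs of independent points *)

Section independent_points.
Context {R : realType}.
Local Notation TR := (measurableTypeR R).
Local Notation mu := (@lebesgue_measure R).
Local Notation disc_area := (@disc_area R).

Lemma measurable_neg_log_dot4 :
  measurable_fun setT (fun z : R4 R * R4 R => neg_log_onem_sqr (dot4 z.1 z.2)).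
Proof.
have mf : measurable_fun setT (neg_log_onem_sqr : R -> \bar R).
  exact: measurable_neg_log_onem_sqr.
by apply: (measurableT_comp mf); rewrite /dot4; meas.
Qed.

Section expectation.
Context d (T : measurableType d) (P : probability T R).

Lemma expectation_neg_log_dot4 (x : R4 R) (Y : {RV P >-> R4 R}) :
  S3 x -> uniform_on_S3 Y ->
  (\int[P]_w neg_log_onem_sqr (dot4 x (Y w)) = (2 * ln 2 - 1)%:E)%E.
Proof.
move=> Sx Yunif.
have mf : measurable_fun setT (fun y => neg_log_onem_sqr (dot4 x y)).
  exact: (measurable_fun_pair2 x measurable_neg_log_dot4).
rewrite (ge0_expectation_uniform _ _ _ Y (fun y => neg_log_onem_sqr (dot4 x y)) Yunif mf); last first.
  by move=> y; exact: neg_log_onem_sqr_ge0.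
rewrite (ge0_integral_ball_zonal x _ Sx measurable_neg_log_onem_sqr neg_log_onem_sqr_ge0).
rewrite disc_integral_neg_log -!EFinM; congr EFin.
rewrite /ball_volume; field.
by rewrite gt_eqF// disc_area_gt0.
Qed.

Lemma mutually_independent_pair {n : nat} (p : 'I_n -> {RV P >-> R4 R}) (i j : 'I_n)
    (A B : set (R4 R)) : mutually_independent p -> i != j ->
    measurable A -> measurable B ->
  P (p i @^-1` A `&` p j @^-1` B) = (P (p i @^-1` A) * P (p j @^-1` B))%E.
Proof.
move=> pind ij mA mB.
have ji : (j == i) = false by rewrite eq_sym; exact: negbTE.
have := pind [set i; j]%SET (fun k => if k == i then A else B) _.
rewrite big_setU1/=; last by rewrite inE.
rewrite big_set1 eqxx ji => <-; last by move=> k _; case: ifP.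
congr (P _); apply/seteqP; split => w /=.
  move=> [Aw Bw] k /=; rewrite !inE => /orP[/eqP ->|/eqP ->]; first by rewrite eqxx.
  by rewrite ji.
move=> h; split.
  by have := h i; rewrite /= !inE !eqxx => /(_ isT).
by have := h j; rewrite /= !inE !eqxx ji orbT => /(_ isT).
Qed.

(** The joint law agrees with the product of the two laws on rectangles, hence everywhere; Tonelli
    then separates the variables. *)
Lemma expectation_pair_independent (X Y : {RV P >-> R4 R}) (f : R4 R * R4 R -> \bar R) :
    (forall A B, measurable A -> measurable B ->
      P (X @^-1` A `&` Y @^-1` B) = (P (X @^-1` A) * P (Y @^-1` B))%E) ->
    measurable_fun setT f -> (forall z, (0 <= f z)%E) ->
  (\int[P]_w f (X w, Y w) = \int[P]_w \int[P]_v f (X w, Y v))%E.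
Proof.
move=> XY mf f0.
have mXY : measurable_fun setT (fun w => (X w, Y w)).
  by apply: measurable_fun_pair; exact: measurable_funP.
pose m : {measure set (R4 R * R4 R) -> \bar R} :=
  measure_function_pushforward__canonical__measure_function_Measure P mXY.
transitivity (\int[m]_z f z)%E; first by rewrite ge0_integral_pushforward.
rewrite (eq_measure_integral (distribution P X \x distribution P Y)%E); last first.
  by move=> C mC _; apply/esym/product_measure_unique => // A B; exact: XY.
rewrite (fubini_tonelli1 f mf f0) /fubini_F ge0_integral_distribution; last 2 first.
- exact: (measurable_fun_fubini_tonelli_F f).
- by move=> x; exact: integral_ge0.
apply: eq_integral => w _ /=.
rewrite ge0_integral_distribution//.
exact: measurable_fun_pair2.
Qed.

Lemma expectation_pair_neg_log {n : nat} (p : 'I_n -> {RV P >-> R4 R}) (i j : 'I_n) :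
    mutually_independent p -> (forall k, uniform_on_S3 (p k)) -> i != j ->
  (\int[P]_w neg_log_onem_sqr (dot4 (p i w) (p j w)) = (2 * ln 2 - 1)%:E)%E.
Proof.
move=> pind punif ij.
rewrite (expectation_pair_independent (p i) (p j)
  (fun z => neg_log_onem_sqr (dot4 z.1 z.2)) _ measurable_neg_log_dot4); last 2 first.
- by move=> A B; exact: mutually_independent_pair.
- by move=> z; exact: neg_log_onem_sqr_ge0.
transitivity (\int[P]_w (2 * ln 2 - 1)%:E)%E.
  apply: eq_integral => w _; apply: expectation_neg_log_dot4 => //.
  by have [] := punif i.
rewrite integral_cst//= -[RHS]mule1; apply: (congr1 (fun z => _ * z)%E).
exact: probability_setT.
Qed.

End expectation.

End independent_points.

(** * The energy of an antipodal configuration *)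

Section energy.
Context {R : realType}.
Local Notation TR := (measurableTypeR R).
Local Notation mu := (@lebesgue_measure R).
Local Notation disc_area := (@disc_area R).

Definition pair_energy (z : R4 R) : \bar R := lne (1 / (enorm z)%:E)%E.

Lemma pair_energyE (z : R4 R) : pair_energy z =
  if 0 < sqnorm4 z then (- (ln (sqnorm4 z) / 2))%:E else +oo%E.
Proof.
rewrite /pair_energy div1e inver.
case: ifPn => [/eqP z0|z0].
  by rewrite -enorm_gt0 z0 ltxx.
have ez : 0 < enorm z by rewrite lt_neqAle eq_sym z0 sqrtr_ge0.
rewrite -enorm_gt0 ez lne_EFin ?invr_gt0// lnV ?posrE// -enorm_sqr lnXn// -[_ *+ 2 in RHS]mulr_natr.
by rewrite mulfK ?pnatr_eq0.
Qed.

Lemma sqnorm4N (z : R4 R) : sqnorm4 (- z) = sqnorm4 z.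
Proof.
transitivity ((- z.1.1) ^+ 2 + (- z.1.2) ^+ 2 + (- z.2.1) ^+ 2 + (- z.2.2) ^+ 2) => //.
by rewrite !sqrrN.
Qed.

Lemma pair_energyN (z : R4 R) : pair_energy (- z) = pair_energy z.
Proof. by rewrite !pair_energyE sqnorm4N. Qed.

Lemma sqnorm4D (x y : R4 R) : S3 x -> S3 y -> sqnorm4 (x + y) = 2 + 2 * dot4 x y.
Proof.
move=> Sx Sy.
have nx : sqnorm4 x = 1 by rewrite -enorm_sqr Sx expr1n.
have ny : sqnorm4 y = 1 by rewrite -enorm_sqr Sy expr1n.
transitivity (sqnorm4 x + sqnorm4 y + 2 * dot4 x y); last by rewrite nx ny; ring.
transitivity ((x.1.1 + y.1.1) ^+ 2 + (x.1.2 + y.1.2) ^+ 2 +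
  (x.2.1 + y.2.1) ^+ 2 + (x.2.2 + y.2.2) ^+ 2) => //.
by rewrite /sqnorm4 /dot4; ring.
Qed.

Lemma S3N (x : R4 R) : S3 x -> S3 (- x).
Proof.
by rewrite /S3/= => <-; rewrite /enorm; congr Num.sqrt; exact: sqnorm4N.
Qed.

Lemma dot4Nr (x y : R4 R) : dot4 x (- y) = - dot4 x y.
Proof.
transitivity (x.1.1 * - y.1.1 + x.1.2 * - y.1.2 + x.2.1 * - y.2.1 + x.2.2 * - y.2.2) => //.
by rewrite /dot4; ring.
Qed.

Lemma pair_energy_antipodal (x : R4 R) : S3 x ->
  (pair_energy (x + x)%R + pair_energy (x + x)%R = (- (2 * ln 2))%:E)%E.
Proof.
move=> Sx; have nx : sqnorm4 x = 1 by rewrite -enorm_sqr Sx expr1n.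
have dx : dot4 x x = 1 by rewrite -nx /dot4 /sqnorm4; ring.
rewrite pair_energyE sqnorm4D// dx mulr1 ltr_pDl// -EFinD; congr EFin.
rewrite (_ : 2 + 2 = 2 ^+ 2 :> R); last by ring.
by rewrite lnXn// -mulr_natl; field.
Qed.

(** The squared distances are 2 - 2 t and 2 + 2 t, with product 4 (1 - t ^ 2); the constant is - ln
    4. *)
Lemma pair_energy_orbit (x y : R4 R) : S3 x -> S3 y ->
  (pair_energy (x - y)%R + pair_energy (x + y)%R + (pair_energy (x - y)%R + pair_energy (x + y)%R) =
   neg_log_onem_sqr (dot4 x y) + (- (2 * ln 2))%:E)%E.
Proof.
move=> Sx Sy; rewrite !pair_energyE (sqnorm4D x (- y) Sx (S3N y Sy)) dot4Nr (sqnorm4D x y Sx Sy).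
have p0 : 0 <= 2 + 2 * dot4 x y by rewrite -(sqnorm4D x y Sx Sy) sqnorm4_ge0.
have n0 : 0 <= 2 + 2 * - dot4 x y by rewrite -dot4Nr -(sqnorm4D x (- y) Sx (S3N y Sy)) sqnorm4_ge0.
set t := dot4 x y in p0 n0 *.
rewrite /neg_log_onem_sqr; case: (ltP (t ^+ 2) 1) => t1.
  have /andP[tl tr] : -1 < t < 1 by rewrite -sqr_lt1_itv.
  have p1 : 0 < 1 + t by lra.
  have n1 : 0 < 1 - t by lra.
  rewrite !ifT; [|lra|lra].
  rewrite -!EFinD; congr EFin.
  rewrite (_ : 2 + 2 * - t = 2 * (1 - t)); last by ring.
  rewrite (_ : 2 + 2 * t = 2 * (1 + t)); last by ring.
  rewrite (_ : 1 - t ^+ 2 = (1 - t) * (1 + t)); last by ring.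
  by rewrite !lnM ?posrE//; field.
(* [p0] and [n0] bound t by 1 in absolute value. At the two extremes one of the distances is 0 and
   both sides are +oo. *)
have [->|->] : t = 1 \/ t = -1.
  have [t0|t0] := leP 0 t; [left|right]; apply/eqP; rewrite eq_le; apply/andP; split; nra.
- by rewrite mulrN1 subrr ltxx mulr1 ltr_pDl//.
- by rewrite opprK mulr1 mulrN1 subrr ltxx ltr_pDl//.
Qed.

(** The double sum splits into four blocks by sign. In the two mixed blocks the diagonal gives the
    pairs (x i, - x i) and (- x i, x i); all other terms group into orbits of four, one for each
    ordered pair i != j. *)
Lemma log_energy_with_antipodes {M : nat} (x : 'I_M -> R4 R) : (forall i, S3 (x i)) ->
  log_energy (with_antipodes x) =
  (\sum_(i < M) ((- (2 * ln 2))%:E +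
     \sum_(j < M | i != j) (neg_log_onem_sqr (dot4 (x i) (x j)) + (- (2 * ln 2))%:E)))%E.
Proof.
move=> Sx; rewrite /log_energy big_split_ord/=.
have xl i : with_antipodes x (lshift M i) = x i.
  by rewrite /with_antipodes (unsplitK (inl i)).
have xr i : with_antipodes x (rshift M i) = - x i.
  by rewrite /with_antipodes (unsplitK (inr i)).
rewrite -big_split/=; apply: eq_bigr => i _.
rewrite !big_split_ord/=.
transitivity (\sum_(j < M | i != j) pair_energy (x i - x j)%R +
    \sum_(j < M) pair_energy (x i + x j)%R +
  (\sum_(j < M) pair_energy (x i + x j)%R +
    \sum_(j < M | i != j) pair_energy (x i - x j)%R))%E.
  congr (_ + _ + (_ + _))%E; apply: eq_big => [j|j _].
  - by rewrite eq_lshift.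
  - by rewrite !xl.
  - by rewrite eq_lrshift.
  - by rewrite xl xr opprK.
  - by rewrite eq_rlshift.
  - by rewrite xl xr -opprD; exact: pair_energyN.
  - by rewrite eq_rshift.
  - by rewrite !xr -opprD; exact: pair_energyN.
have -> : (\sum_(j < M) pair_energy (x i + x j)%R =
    pair_energy (x i + x i)%R + \sum_(j < M | i != j) pair_energy (x i + x j)%R)%E.
  rewrite (bigD1 i)//=; congr (_ + _)%E.
  by apply: eq_bigl => j; rewrite eq_sym.
under [in RHS]eq_bigr => j _ do rewrite -(pair_energy_orbit (x i) (x j) (Sx i) (Sx j)).
rewrite -(pair_energy_antipodal (x i) (Sx i)).
(* Only commutativity and associativity in [\bar R] enter, so infinite terms are harmless. *)
have sumC (u v w : \bar R) : (u + (v + w) + (v + w + u) = v + v + (u + w + (u + w)))%E.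
  by rewrite (addeC (v + w)%E u) (addeCA u v w) addeACA.
by rewrite !big_split/= sumC.
Qed.

Lemma expectation_log_energy d (T : measurableType d) (P : probability T R) (M : nat)
    (p : 'I_M -> {RV P >-> R4 R}) :
    mutually_independent p -> (forall i, uniform_on_S3 (p i)) ->
  (\int[P]_w log_energy (with_antipodes (fun i => p i w)) =
   (- (2 * ln 2) * M%:R ^+ 2 + (2 * ln 2 - 1) * (M%:R ^+ 2 - M%:R))%:E)%E.
Proof.
move=> pind punif.
pose c : R := 2 * ln 2.
pose f (ij : 'I_M * 'I_M) w := neg_log_onem_sqr (dot4 (p ij.1 w) (p ij.2 w)).
(* The double sum is flattened into one sum over a list of pairs, the form that [ge0_integral_sum]
   integrates term by term. *)
pose S w := (\sum_(ij <- enum [pred ij : 'I_M * 'I_M | ij.1 != ij.2]) f ij w)%E.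
have mf ij : measurable_fun setT (f ij).
  have mp : measurable_fun setT (fun w => (p ij.1 w, p ij.2 w)).
    by apply: measurable_fun_pair; exact: measurable_funP.
  exact: (measurableT_comp measurable_neg_log_dot4 mp).
have f0 ij w : (0 <= f ij w)%E by exact: neg_log_onem_sqr_ge0.
have card_sum (k : R) : (\sum_(i < M) \sum_(j < M | i != j) k = k * (M%:R ^+ 2 - M%:R)).
  have total : \sum_(j < M) k = k * M%:R by rewrite sumr_const card_ord mulr_natr.
  transitivity (\sum_(i < M) k * (M%:R - 1)).
    apply: eq_bigr => i _; rewrite mulrBr mulr1 -total [X in _ = X - _](bigD1 i)//= addrAC subrr add0r.
    by apply: eq_bigl => j; rewrite eq_sym.
  by rewrite sumr_const card_ord -mulr_natr; ring.
(* The constant - c occurs M times from antipodal pairs and M ^ 2 - M times from orbits, M ^ 2 times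
   in all. *)
have energyE w : log_energy (with_antipodes (fun i => p i w)) =
    ((- c * M%:R ^+ 2)%:E + S w)%E.
  rewrite log_energy_with_antipodes; last by move=> i; have [] := punif i.
  rewrite big_split/=; under [X in (_ + X)%E]eq_bigr do rewrite big_split/=.
  rewrite big_split/= addeCA addeC.
  congr (_ + _)%E.
    under [X in (_ + X)%E]eq_bigr do rewrite sumEFin.
    rewrite !sumEFin -EFinD; congr EFin.
    rewrite card_sum sumr_const card_ord -[_ *+ M]mulr_natr /c; ring.
  by rewrite /S big_enum pair_big_dep.
have intS : (\int[P]_w S w = ((2 * ln 2 - 1) * (M%:R ^+ 2 - M%:R))%:E)%E.
  rewrite ge0_integral_sum//.
  transitivity (\sum_(i < M) \sum_(j < M | i != j) (2 * ln 2 - 1 : R)%:E)%E.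
    rewrite big_enum pair_big_dep; apply: eq_bigr => -[i j] ij.
    exact: expectation_pair_neg_log.
  by under eq_bigr do rewrite sumEFin; rewrite sumEFin card_sum.
have S0 w : (0 <= S w)%E by apply: sume_ge0 => ij _; exact: f0.
have mS : measurable_fun setT S by apply: emeasurable_sum.
(* The constant is negative, so splitting the integral needs integrability; it follows from
   nonnegativity and the finite value [intS]. *)
have iS : P.-integrable setT S.
  apply/integrableP; split => //.
  by under eq_integral do rewrite gee0_abs//; rewrite intS ltry.
under eq_integral do rewrite energyE.
rewrite integralD//; last exact: finite_measure_integrable_cst.
rewrite intS integral_cst// EFinD; congr (_ + _)%E.
rewrite -[RHS]mule1; apply: (congr1 (fun z => _ * z)%E).
exact: probability_setT.
Qed.

End energy.

Theorem lemma2p2 (R : realType) (d : measure_display) (T : measurableType d)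
    (P : probability T R) (M N : nat) (p : 'I_M -> {RV P >-> R4 R})
    (p_indep : mutually_independent p)
    (p_unif : forall i : 'I_M, uniform_on_S3 (p i))
    (N_eq : N = (2 * M)%N) :
  (\int[P]_w log_energy (with_antipodes (fun i : 'I_M => p i w)))%E =
  (- (1 / 4) * N%:R ^+ 2 + (1 / 2 - ln 2) * N%:R)%:E.
Proof.
(* The terms in M ^ 2 ln 2 cancel, and both sides equal - M ^ 2 + (1 - 2 ln 2) M. *)
rewrite (expectation_log_energy _ _ _ _ _ p_indep p_unif) N_eq natrM.
by congr EFin; field.
Qed.
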